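(* Let $(\Sigma_2,\sigma)$ be the full shift on two symbols. The space $\mathcal{S}(\Sigma_2,\sigma)$ of strictly ergodic subsets of $(\Sigma_2,\sigma)$, with the weak topology, contains a subspace homeomorphic to the Hilbert cube, and the space $\mathcal{D}(\Sigma_2,\sigma)$ of Denjoy minimal sets in $(\Sigma_2,\sigma)$, with the weak topology, contains topological balls of dimension $n$ for all natural numbers $n$.
   Context: $\Sigma_2=\{0,1\}^{\mathbb{Z}}$ with the product topology and $\sigma$ is the shift homeomorphism, $(\sigma(s))_i=s_{i+1}$. Let $(X,h)$ be a dynamical system, i.e. $X$ is a compact metric space and $h:X\to X$ a homeomorphism. It is a minimal set if every orbit $\{h^n(x):n\in\mathbb{Z}\}$ is dense; uniquely ergodic if it has exactly one invariant Borel probability measure; strictly ergodic if it is both minimal and uniquely ergodic. A compact $h$-invariant subset $Y\subset X$ is said to have one of these properties if $(Y,h|_Y)$ does. A Denjoy example is an (orientation-preserving) circle homeomorphism $g:S^1\to S^1$ with irrational rotation number such that $(S^1,g)$ is not minimal; it has a unique minimal set. A dynamical system is called a Denjoy minimal set if it is topologically conjugate to the restriction of some Denjoy example to its unique minimal set. Every Denjoy minimal set is strictly ergodic. $\mathcal{S}(X,h)=\{Y\subset X: Y \text{ compact, } h\text{-invariant, and } (Y,h) \text{ strictly ergodic}\}$ and $\mathcal{D}(X,h)=\{Y\subset X: Y\text{ compact, } h\text{-invariant, and } (Y,h)\text{ is a Denjoy minimal set}\}\subset\mathcal{S}(X,h)$. Weak topology: let $\mathcal{M}(X,h)$ be the set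 of $h$-invariant Borel probability measures on $X$, with $\mu_n\to\mu_0$ iff $\int f\,d\mu_n\to\int f\,d\mu_0$ for all continuous $f:X\to\mathbb{R}$. Sending a strictly ergodic set to its unique invariant probability measure gives an injection $\mathcal{S}(X,h)\hookrightarrow\mathcal{M}(X,h)$; the weak topology on $\mathcal{S}(X,h)$ and on $\mathcal{D}(X,h)$ is the topology induced by this injection. *)

(* Defs.v *)
From HB Require Import structures.
From mathcomp Require Import all_boot all_order all_algebra.
From mathcomp Require Import all_classical all_reals all_analysis.
Import Order.TTheory GRing.Theory Num.Theory.
Import numFieldNormedType.Exports.

Set Implicit Arguments.
Unset Strict Implicit.
Unset Printing Implicit Defensive.

Local Open Scope classical_set_scope.
Local Open Scope ring_scope.

Definition homeomorphism (T U : topologicalType) (f : T -> U) : Prop :=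
  exists g : U -> T, [/\ cancel f g, cancel g f, continuous f & continuous g].

Definition homeomorphic (T U : topologicalType) : Prop :=
  exists f : T -> U, homeomorphism f.

(* The type [A] below is [set_type A], which carries the subspace topology. *)
Definition contains_copy (T U : topologicalType) : Prop :=
  exists A : set T, homeomorphic U A.

Section Dynamics.
Variables (X : topologicalType) (h : X -> X).

(* Two-sided orbit, for bijective [h]: in the second case [y] is the image of
   [x] under the [n]-th iterate of the inverse of [h]. *)
Definition full_orbit (x : X) : set X :=
  [set y | exists n : nat, y = iter n h x \/ x = iter n h y].

Definition minimal_system : Prop := forall x : X, dense (full_orbit x).

(* Subsystems are nonempty: no minimal set and no uniquely ergodic set is
   empty, and [measurableType] requires a pointed carrier. *)
Record subsystem := Subsystem {
  carrier : set X;
  _ : compact carrier;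
  _ : h @` carrier = carrier;
  _ : carrier !=set0 }.

HB.instance Definition _ := gen_eqMixin subsystem.
HB.instance Definition _ := gen_choiceMixin subsystem.

Lemma carrier_image (Y : subsystem) : h @` carrier Y = carrier Y.
Proof. by case: Y. Qed.

Lemma carrier_neq0 (Y : subsystem) : carrier Y !=set0.
Proof. by case: Y. Qed.

Definition subspace_of (Y : subsystem) : Type := set_type (carrier Y).

HB.instance Definition _ (Y : subsystem) :=
  Topological.copy (subspace_of Y) (set_type (carrier Y)).

HB.instance Definition _ (Y : subsystem) :=
  isPointed.Build (subspace_of Y)
    (exist _ (projT1 (cid (carrier_neq0 Y)))
       (mem_set (projT2 (cid (carrier_neq0 Y))))).

Definition inclusion (Y : subsystem) (y : subspace_of Y) : X := set_val y.

Lemma subsystem_map_subproof (Y : subsystem) (y : subspace_of Y) :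
  h (inclusion y) \in carrier Y.
Proof.
apply/mem_set; rewrite -(carrier_image Y); exists (inclusion y) => //.
exact: set_valP.
Qed.

Definition subsystem_map (Y : subsystem) (y : subspace_of Y) : subspace_of Y :=
  exist _ (h (inclusion y)) (subsystem_map_subproof y).

End Dynamics.

Arguments inclusion {X h} Y y.
Arguments subsystem_map {X h} Y y.

Definition conjugate (X Z : topologicalType) (h : X -> X) (k : Z -> Z) : Prop :=
  exists f : X -> Z, homeomorphism f /\ f \o h = k \o f.

Definition borel (X : ptopologicalType) := g_sigma_algebraType (@open X).

Section Measures.
Variables (R : realType) (X : ptopologicalType) (h : X -> X).

Definition is_invariant (mu : probability (borel X) R) : Prop :=
  forall A : set (borel X), measurable A -> mu (h @^-1` A) = mu A.

(* A library measure is a function on all subsets, with unconstrained values on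
   the non-measurable ones, so measures are compared on Borel sets only. *)
Definition uniquely_ergodic : Prop :=
  exists2 mu : probability (borel X) R, is_invariant mu &
    forall nu : probability (borel X) R, is_invariant nu ->
      forall A : set (borel X), measurable A -> nu A = mu A.

Definition strictly_ergodic : Prop := minimal_system h /\ uniquely_ergodic.

Definition integrals (mu : set_type is_invariant) :
    {ptws continuousType X R -> R} :=
  fun f => \int[val mu]_x f x.

(* The topology of convergence of the integrals of all continuous functions *)
Definition invariant_measures : Type := initial_topology integrals.

HB.instance Definition _ := Topological.on invariant_measures.

End Measures.

Section StrictlyErgodicSets.
Variables (R : realType) (X : ptopologicalType) (h : X -> X).

Lemma inclusion_measurable (Y : subsystem h) :
  measurable_fun [set: borel (subspace_of Y)]
    (inclusion Y : borel (subspace_of Y) -> borel X).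
Proof.
apply: (@measurability _ _ (borel (subspace_of Y)) (borel X) _ _ open) => //.
move=> _ [B oB <-].
by rewrite setTI; apply: sub_sigma_algebra; exists B.
Qed.

HB.instance Definition _ (Y : subsystem h) :=
  isMeasurableFun.Build _ _ (borel (subspace_of Y)) (borel X)
    (inclusion Y : borel (subspace_of Y) -> borel X) (@inclusion_measurable Y).

Definition is_ergodic_set (Y : subsystem h) : Prop :=
  strictly_ergodic R (subsystem_map Y).

(* The unique invariant measure of [Y], seen as a measure on [X]; it does not
   depend, on Borel sets, on the measure picked by [cid2]. *)
Definition ergodic_measure_on (Y : set_type is_ergodic_set) :
    probability (borel (subspace_of (val Y))) R :=
  s2val (cid2 (proj2 (set_valP Y))).

Definition extended_measure (Y : set_type is_ergodic_set) :
    probability (borel X) R :=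
  distribution (ergodic_measure_on Y) (inclusion (val Y)).

Lemma extended_measure_invariant (Y : set_type is_ergodic_set) :
  extended_measure Y \in (is_invariant h : set _).
Proof.
apply/mem_set => A mA; rewrite /extended_measure /distribution /pushforward.
have mYA : measurable ((inclusion (val Y)
    : borel (subspace_of (val Y)) -> borel X) @^-1` A).
  by rewrite -[X in measurable X]setTI; exact: inclusion_measurable.
exact: (s2valP (cid2 (proj2 (set_valP Y))) _ mYA).
Qed.

Definition ergodic_measure (Y : set_type is_ergodic_set) :
    invariant_measures R h :=
  exist _ (extended_measure Y) (extended_measure_invariant Y)
    : set_type (@is_invariant R X h).

Definition ergodic_sets : Type := initial_topology ergodic_measure.

HB.instance Definition _ := Topological.on ergodic_sets.

End StrictlyErgodicSets.

Section Denjoy.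
Variable R : realType.

Definition circle : Type :=
  set_type [set z : R * R | z.1 ^+ 2 + z.2 ^+ 2 = 1].

HB.instance Definition _ := Topological.on circle.

Lemma circle_cover_subproof (t : R) :
  (cos (2 * pi * t), sin (2 * pi * t)) \in
    [set z : R * R | z.1 ^+ 2 + z.2 ^+ 2 = 1].
Proof. by apply/mem_set; exact: cos2Dsin2. Qed.

Definition circle_cover (t : R) : circle :=
  exist _ (cos (2 * pi * t), sin (2 * pi * t)) (circle_cover_subproof t).

(* For a homeomorphism [g], [F (t + 1) = F t + 1] follows. *)
Definition increasing_lift (g : circle -> circle) (F : R -> R) : Prop :=
  [/\ continuous F, {homo F : s t / s < t} &
      forall t, g (circle_cover t) = circle_cover (F t)].

Definition orientation_preserving (g : circle -> circle) : Prop :=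
  exists F : R -> R, increasing_lift g F.

(* The rotation number of [g] is the class modulo 1 of the reals [rho] such that
   [rotation_number g rho] holds. *)
Definition rotation_number (g : circle -> circle) (rho : R) : Prop :=
  exists2 F : R -> R, increasing_lift g F &
    forall t, (iter n F t - t) / n%:R @[n --> \oo] --> rho.

Definition denjoy_example (g : circle -> circle) : Prop :=
  [/\ homeomorphism g, orientation_preserving g,
      exists2 rho, rotation_number g rho & irrational rho &
      ~ minimal_system g].

(* A minimal set of [g] is a subsystem [K] with
   [minimal_system (subsystem_map K)]; a Denjoy example has only one. *)
Definition denjoy_minimal (X : topologicalType) (h : X -> X) : Prop :=
  exists2 g : circle -> circle, denjoy_example g &
    exists2 K : subsystem g, minimal_system (subsystem_map K) &
      conjugate h (subsystem_map K).

(* Denjoy minimal sets are strictly ergodic, so this is the set of all of them;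
   it inherits the subspace topology of [ergodic_sets]. *)
Definition denjoy_sets (X : ptopologicalType) (h : X -> X) :
    set (ergodic_sets R h) :=
  [set Y | denjoy_minimal (subsystem_map (val Y))].

End Denjoy.

Arguments denjoy_sets R {X} h _.

Definition Sigma2 : Type := {ptws int -> bool}.

HB.instance Definition _ := Topological.on Sigma2.
HB.instance Definition _ := Pointed.on Sigma2.

Definition shift_map (s : Sigma2) : Sigma2 := fun i => s (i + 1).

Definition hilbert_cube (R : realType) : Type :=
  {ptws nat -> set_type (`[0, 1]%classic : set R)}.

HB.instance Definition _ (R : realType) := Topological.on (hilbert_cube R).

Definition euclidean_ball (R : realType) (n : nat) : Type :=
  set_type [set x : 'rV[R]_n | \sum_(i < n) x ord0 i ^+ 2 <= 1].

HB.instance Definition _ (R : realType) (n : nat) :=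
  Topological.on (euclidean_ball R n).

(* Main.v *)
(* Code the rotation by an irrational alpha with a 1-periodic, right locally
   constant f : R -> bool, that is, take the orbit closure Y_f of the sequences
   i |-> f (x + i alpha). Density of the orbits of the rotation makes Y_f minimal.
   A point of Y_f agrees on every finite window with such a sequence, so the
   frequency of a word is controlled by the visits of the rotation to a set of
   the circle; comparing these visits with their average over all starting points
   shows that the image of Lebesgue measure is the only invariant measure.

   Let f be the indicator of [0, 1/2) and of bars accumulating at 1 from the left,
   whose lengths are the parameters. The measure on Y_f depends continuously on
   the parameters, because changing them changes f on a set of small measure.
   Conversely, equal measures have equal supports, hence f is determined up to a
   translation, which the long bar [0, 1/2) forbids. By compactness this embeds
   the Hilbert cube. With n bars f also has left limits: blowing up the orbits of
   its discontinuities gives a Denjoy example whose minimal set, coded by f, is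
   conjugate to Y_f. *)

From HB Require Import structures.
Require Import Defs.
From mathcomp Require Import all_boot all_order all_algebra.
From mathcomp Require Import all_classical all_reals all_analysis.
From mathcomp Require Import measurable_realfun.
From mathcomp Require Import ring lra zify.
Import Order.TTheory GRing.Theory Num.Theory.
Import numFieldNormedType.Exports.

Set Implicit Arguments.
Unset Strict Implicit.
Unset Printing Implicit Defensive.

Local Open Scope classical_set_scope.
Local Open Scope ring_scope.

(** * Rotations and the full shift *)

(** With infinitely many bars f has no left limit at 1, so Y_f is not visibly a rotation with some
    orbits doubled. What remains is a base point: a limit rho of starting points, along whose orbit
    a point of Y_f has the symbols of f wherever f is locally constant. Right local constancy makes
    such times plentiful, since the dense orbit enters the interior of any right neighbourhood on
    which f is constant. Minimality, the recovery of f from the measure and the injectivity of the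
    coding of the Cantor set all rest on this. It also replaces Jordan measurability: a set open to
    the right exceeds its interior by countably many points, so it is filled in measure by sets of
    points having a margin d inside it. The margin absorbs the error of the density theorem in the
    frequency estimate. Bars keep away from the ends of their blocks, so f vanishes at 1/2 and at
    points tending to 1; a nontrivial translation would carry one of these zeros into [0, 1/2).
    Minimality of the Cantor set is not proved on the circle: the conjugacy carries it over from
    Y_f. *)

Section Density.
Variable R : realType.
Implicit Types (x th d : R).

Definition fpart x : R := x - (Num.floor x)%:~R.

Lemma fpart_itv x : 0 <= fpart x < 1.
Proof.
have /andP[h1 h2] := floor_itv x.
by rewrite /fpart subr_ge0 h1 ltrBlDl; rewrite intrD in h2.
Qed.

Lemma fpart_ge0 x : 0 <= fpart x. Proof. by case/andP: (fpart_itv x). Qed.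

Lemma fpart_lt1 x : fpart x < 1. Proof. by case/andP: (fpart_itv x). Qed.

Lemma fpart_unique x (m : int) : m%:~R <= x < m%:~R + 1 -> fpart x = x - m%:~R.
Proof. by move=> h; rewrite /fpart (@floor_def _ x m)// intrD. Qed.

Lemma fpart_id x : 0 <= x < 1 -> fpart x = x.
Proof. by move=> h; rewrite (@fpart_unique _ 0) ?subr0 ?add0r. Qed.

Lemma fpartDint x (m : int) : fpart (x + m%:~R) = fpart x.
Proof.
rewrite (@fpart_unique _ (Num.floor x + m)) /fpart; first by rewrite intrD; ring.
have /andP[h1 h2] := floor_itv x; rewrite intrD in h2.
by rewrite intrD; apply/andP; split; lra.
Qed.

(** Dirichlet's pigeonhole: [M + 1] fractional parts fall into [M] boxes of width less than [d], so
    two share a box; irrationality keeps their difference from vanishing. *)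
Lemma small_multiple (alpha : R) d : irrational alpha -> 0 < d ->
  exists (k : nat) (m : int), 0 < `|k%:R * alpha - m%:~R| < d.
Proof.
move=> irr d0; pose M := (Num.trunc d^-1).+1.
have M0 : 0 < M%:R :> R by rewrite ltr0n.
have Md : M%:R^-1 < d.
  rewrite -[d]invrK ltf_pV2 ?posrE ?invr_gt0//.
  by have /andP[] := truncn_itv (ltW (etrans (invr_gt0 d) d0)).
have box_lt (k : 'I_M.+1) : (Num.trunc (M%:R * fpart (k%:R * alpha)) < M)%N.
  rewrite truncn_lt_nat ?mulr_ge0 ?fpart_ge0// -[ltRHS]mulr1 ltr_pM2l//.
  exact: fpart_lt1.
pose box (k : 'I_M.+1) := Ordinal (box_lt k).
have /injectivePn[i [j ij bij]] : ~~ injectiveb box.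
  by apply/negP => /injectiveP /leq_card; rewrite !card_ord ltnn.
have clash : `|fpart (i%:R * alpha) - fpart (j%:R * alpha)| < M%:R^-1.
  have /(congr1 val)/= bE := bij.
  have := truncn_itv (mulr_ge0 (ltW M0) (fpart_ge0 (i%:R * alpha))).
  have := truncn_itv (mulr_ge0 (ltW M0) (fpart_ge0 (j%:R * alpha))).
  rewrite bE -natr1 => /andP[h1 h2] /andP[h3 h4].
  rewrite -(ltr_pM2l M0) divff ?gt_eqF// -{1}(ger0_norm (ltW M0)) -normrM.
  by rewrite ltr_norml; apply/andP; split; lra.
have key (p q : nat) : (p < q)%N ->
    `|fpart (q%:R * alpha) - fpart (p%:R * alpha)| < d ->
    exists (k : nat) (m : int), 0 < `|k%:R * alpha - m%:~R| < d.
  move=> pq h; exists (q - p)%N.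
  exists (Num.floor (q%:R * alpha) - Num.floor (p%:R * alpha)).
  have -> : (q - p)%:R * alpha
      - (Num.floor (q%:R * alpha) - Num.floor (p%:R * alpha))%:~R
      = fpart (q%:R * alpha) - fpart (p%:R * alpha).
    by rewrite /fpart natrB ?(ltnW pq)// intrB; ring.
  rewrite h andbT normr_gt0; apply/eqP => e0; apply: irr.
  apply/rationalP; exists (Num.floor (q%:R * alpha) - Num.floor (p%:R * alpha)).
  exists (q - p)%N; have qp0 : (q - p)%:R != 0 :> R.
    by rewrite pnatr_eq0 subn_eq0 -ltnNge.
  apply: (mulfI qp0); rewrite [RHS]mulrCA divff ?mulr1//.
  move: e0; rewrite /fpart natrB ?(ltnW pq)// intrB => e0.
  by lra.
have /orP[lij|lji] : (i < j)%N || (j < i)%N by rewrite -neq_ltn.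
- by apply: (key _ _ lij); rewrite distrC (lt_trans clash).
- by apply: (key _ _ lji); rewrite (lt_trans clash).
Qed.

(** Multiples of a nonzero step shorter than [d] sweep the circle. The bound [K] on the time does
    not depend on the target [th]; this uniformity later bounds the cost of moving a starting
    point. *)
Lemma orbit_dense (alpha : R) d : irrational alpha -> 0 < d ->
  exists K : nat, forall th,
    exists (k : nat) (m : int), (k < K)%N /\ `|th + m%:~R - k%:R * alpha| < d.
Proof.
move=> irr d0; have [k0 [m0 /andP[b0 bd]]] := small_multiple irr d0.
set b := k0%:R * alpha - m0%:~R in b0 bd.
exists (k0 * (Num.trunc `|b|^-1).+1).+1 => th.
have step (t : R) : exists (j : nat) (m : int),
    (j <= Num.trunc `|b|^-1)%N /\ `|t + m%:~R - j%:R * `|b| | < d.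
  exists (Num.trunc (fpart t / `|b|)), (- Num.floor t); split.
    apply: le_truncn; rewrite -[leRHS]mul1r ler_wpM2r ?invr_ge0//.
    exact/ltW/fpart_lt1.
  have q0 : 0 <= fpart t / `|b| by rewrite divr_ge0 ?fpart_ge0 ?normr_ge0.
  have /andP[] := truncn_itv q0; rewrite ler_pdivlMr// ltr_pdivrMr// -natr1.
  move=> h1 h2; rewrite intrN -/(fpart t); apply: le_lt_trans bd.
  by rewrite ler_norml; apply/andP; split; lra.
have [bpos|bneg] := leP 0 b.
- have [j [m [jK h]]] := step th.
  exists (k0 * j)%N, (m + m0 * j%:Z); split; first by rewrite ltnS leq_mul// ltnW.
  rewrite (ger0_norm bpos) in h; apply: le_lt_trans h.
  by rewrite /b natrM intrD intrM -pmulrn le_eqVlt; apply/orP; left; apply/eqP;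
    congr `| _ |; ring.
(* A negative step moves backwards, so its multiples are compared with [- th]. *)
- have [j [m [jK h]]] := step (- th).
  exists (k0 * j)%N, (m0 * j%:Z - m); split; first by rewrite ltnS leq_mul// ltnW.
  rewrite (ltr0_norm bneg) -normrN in h; apply: le_lt_trans h.
  by rewrite /b natrM intrB intrM -pmulrn le_eqVlt; apply/orP; left; apply/eqP;
    congr `| _ |; ring.
Qed.

End Density.

(** * Topology of the full shift *)

Section FullShift.
Implicit Types (s t : Sigma2) (N : nat).

Definition agree N s t := forall i : int, (`|i| <= N)%N -> s i = t i.

Lemma agreeC N s t : agree N s t -> agree N t s.
Proof. by move=> h i iN; rewrite h. Qed.

Lemma agree_trans N s t u : agree N s t -> agree N t u -> agree N s u.
Proof. by move=> h1 h2 i iN; rewrite h1// h2. Qed.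

Lemma agreeW N M s t : (N <= M)%N -> agree M s t -> agree N s t.
Proof. by move=> NM h i iN; rewrite h// (leq_trans iN). Qed.

Lemma Sigma2_coord_continuous (i : int) : continuous (fun s : Sigma2 => s i).
Proof. exact: (@proj_continuous int (fun=> bool) i). Qed.

Lemma nbhs_coord s (i : int) : nbhs s [set t : Sigma2 | s i = t i].
Proof.
apply: (@Sigma2_coord_continuous i s [set b | s i = b]).
by apply: open_nbhs_nbhs; split => //; exact: discrete_open.
Qed.

Lemma nbhs_agree s N : nbhs s [set t : Sigma2 | agree N s t].
Proof.
elim: N => [|N IH].
  apply: filterS (nbhs_coord s 0) => t /= h i.
  by rewrite leqn0 absz_eq0 => /eqP ->.
apply: filterS (filterI IH (filterI (nbhs_coord s N.+1) (nbhs_coord s (- N.+1%:Z)))).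
move=> t [/= h [hp hn]] i; rewrite leq_eqVlt => /orP[/eqP iN|]; last exact: h.
by have [->|->] : i = N.+1 \/ i = - N.+1%:Z by lia.
Qed.

(** The cylinders around [s] generate a filter that converges to [s] in each coordinate, hence in
    the product topology; so it contains every neighbourhood of [s]. *)
Lemma nbhs_Sigma2 s (U : set Sigma2) :
  nbhs s U -> exists N, forall t, agree N s t -> U t.
Proof.
pose F : set_system Sigma2 :=
  filter_from setT (fun N => [set t | agree N s t]).
have FF : Filter F.
  apply: filter_from_filter; first by exists 0%N.
  move=> i j _ _; exists (maxn i j) => // t /= h.
  by split; apply: agreeW h; rewrite (leq_maxl, leq_maxr).
have Fs : F --> s.
  apply/cvg_sup => i U' [V [[W oW <-]] /= Wsi WU].
  by exists `|i|%N => // t /= h; apply: WU => /=; rewrite -(h i).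
by move=> /Fs [N _ NU]; exists N.
Qed.

Lemma Sigma2_compact : compact [set: Sigma2].
Proof.
have := @tychonoff int (fun=> bool) (fun=> setT) (fun=> bool_compact).
by congr compact; apply/seteqP; split.
Qed.

Lemma Sigma2_hausdorff : hausdorff_space Sigma2.
Proof.
apply: (@hausdorff_product int (fun=> bool)) => _.
exact: discrete_hausdorff.
Qed.

Definition unshift_map (s : Sigma2) : Sigma2 := fun i => s (i - 1).

Lemma unshift_mapK : cancel unshift_map shift_map.
Proof. by move=> s; apply/funext => i; rewrite /shift_map /unshift_map addrK. Qed.

Lemma shift_mapK : cancel shift_map unshift_map.
Proof. by move=> s; apply/funext => i; rewrite /shift_map /unshift_map subrK. Qed.

Lemma iter_shift_map n s (i : int) : iter n shift_map s i = s (i + n%:Z).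
Proof.
elim: n i => [|n IH] i; first by rewrite addr0.
by rewrite iterS {1}/shift_map IH -addrA; congr s; lia.
Qed.

Lemma continuous_agree (T : topologicalType) (g : T -> Sigma2) :
  (forall x N, nbhs x [set y | agree N (g x) (g y)]) -> continuous g.
Proof.
move=> h x U /nbhs_Sigma2[N NU].
by apply: filterS (h x N) => y /NU.
Qed.

Lemma shift_map_continuous : continuous shift_map.
Proof.
apply: continuous_agree => s N; apply: filterS (nbhs_agree s N.+1) => t h i iN.
by rewrite /shift_map h//; lia.
Qed.

End FullShift.

Lemma inclusion_iter (X : topologicalType) (h : X -> X) (Y : subsystem h)
    (n : nat) (y : subspace_of Y) :
  inclusion Y (iter n (subsystem_map Y) y) = iter n h (inclusion Y y).
Proof. by elim: n => //= n <-. Qed.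

Lemma inclusion_inj (X : topologicalType) (h : X -> X) (Y : subsystem h) :
  injective (inclusion Y).
Proof. by move=> y z /val_inj. Qed.

Lemma inclusion_continuous (X : topologicalType) (h : X -> X) (Y : subsystem h) :
  continuous (inclusion Y).
Proof. exact: initial_continuous. Qed.

Lemma inclusionP (X : topologicalType) (h : X -> X) (Y : subsystem h) y :
  carrier Y (inclusion Y y).
Proof. exact: set_valP. Qed.

(** * Codings of a rotation and their minimality *)

Section SymbolFunctions.
Variable R : realType.
Implicit Types (f : R -> bool) (x y e : R) (N : nat).

Definition periodic1 (T : Type) (f : R -> T) := forall x, f (x + 1) = f x.

(** Continuity for the Sorgenfrey topology on the line and the discrete one on [bool]. *)
Definition right_locally_constant f :=
  forall x, exists2 e, 0 < e & forall y, x <= y < x + e -> f y = f x.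

Definition locally_constant_at f x :=
  exists2 e, 0 < e & forall y, `|y - x| < e -> f y = f x.

Lemma periodic1_int (T : Type) (f : R -> T) (m : int) x :
  periodic1 f -> f (x + m%:~R) = f x.
Proof.
move=> fper; have nper (n : nat) z : f (z + n%:R) = f z.
  by elim: n z => [|n IH] z; rewrite ?addr0// -natr1 addrA fper.
case: m => n; first by rewrite -pmulrn nper.
by rewrite NegzE intrN -pmulrn -(nper n.+1 (x - n.+1%:R)) subrK.
Qed.

Lemma locally_constant_inside f x y e :
  (forall z, x <= z < x + e -> f z = f x) -> x < y < x + e ->
  locally_constant_at f y.
Proof.
move=> fx /andP[xy yx]; exists (Num.min (y - x) (x + e - y)).
  by rewrite lt_min !subr_gt0 xy yx.
move=> z; rewrite lt_min !ltr_norml => /andP[/andP[h1 h2] /andP[h3 h4]].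
by rewrite !fx//; apply/andP; split; lra.
Qed.

Variables (alpha : R) (f : R -> bool).

Definition itinerary x : Sigma2 := fun i : int => f (x + i%:~R * alpha).

Lemma shift_itinerary x : shift_map (itinerary x) = itinerary (x + alpha).
Proof.
by apply/funext => i; rewrite /shift_map /itinerary intrD mulrDl mul1r; congr f; ring.
Qed.

Lemma unshift_itinerary x : unshift_map (itinerary x) = itinerary (x - alpha).
Proof. by rewrite -[RHS]shift_mapK shift_itinerary subrK. Qed.

Definition coding : set Sigma2 := closure (range itinerary).

Lemma codingP (s : Sigma2) :
  coding s <-> forall N, exists x, agree N s (itinerary x).
Proof.
split=> [cs N|h U /nbhs_Sigma2[N NU]].
  by have [_ [[x _ <-] h]] := cs _ (nbhs_agree s N); exists x.
by have [x hx] := h N; exists (itinerary x); split; [exists x|exact: NU].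
Qed.

Lemma itinerary_coding x : coding (itinerary x).
Proof. by apply: subset_closure; exists x. Qed.

Lemma coding_compact : compact coding.
Proof.
by apply: (subclosed_compact _ Sigma2_compact) => //; exact: closed_closure.
Qed.

Lemma shift_coding : shift_map @` coding = coding.
Proof.
apply/seteqP; split=> [_ [s cs <-]|s cs].
  apply/codingP => N; have [x hx] := (codingP s).1 cs N.+1.
  exists (x + alpha); rewrite -shift_itinerary => i iN.
  by rewrite /shift_map hx//; lia.
exists (unshift_map s); last exact: unshift_mapK.
apply/codingP => N; have [x hx] := (codingP s).1 cs N.+1.
exists (x - alpha); rewrite -unshift_itinerary => i iN.
by rewrite /unshift_map hx//; lia.
Qed.

Lemma coding_neq0 : coding !=set0.
Proof. by exists (itinerary 0); exact: itinerary_coding. Qed.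

Definition coding_system : subsystem shift_map :=
  Subsystem coding_compact shift_coding coding_neq0.

Hypothesis alpha_irr : irrational alpha.
Hypothesis f_per : periodic1 f.
Hypothesis f_rlc : right_locally_constant f.

Lemma itineraryDint x (m : int) : itinerary (x + m%:~R) = itinerary x.
Proof.
by apply/funext => i; rewrite /itinerary addrAC periodic1_int.
Qed.

Lemma itinerary_fpart x : itinerary (fpart x) = itinerary x.
Proof. by rewrite /fpart -intrN itineraryDint. Qed.

Lemma itinerary_right x N :
  exists2 e, 0 < e & forall y, x <= y < x + e -> agree N (itinerary x) (itinerary y).
Proof.
have one (i : int) : exists2 e, 0 < e &
    forall y, x <= y < x + e -> itinerary x i = itinerary y i.
  have [e e0 he] := f_rlc (x + i%:~R * alpha); exists e => // y /andP[h1 h2].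
  by rewrite /itinerary [RHS]he//; apply/andP; split; lra.
elim: N => [|N [e e0 he]].
  have [e e0 he] := one 0; exists e => // y /he h i.
  by rewrite leqn0 absz_eq0 => /eqP ->.
have [e1 e10 he1] := one N.+1; have [e2 e20 he2] := one (- N.+1%:Z).
exists (Num.min e (Num.min e1 e2)); first by rewrite !lt_min e0 e10.
move=> y; rewrite -ltrBlDl !lt_min !ltrBlDl => /andP[xy /andP[h /andP[h1 h2]]] i.
rewrite leq_eqVlt => /orP[/eqP iN|iN]; last by apply: he => //; rewrite xy.
have [->|->] : i = N.+1 \/ i = - N.+1%:Z by lia.
  by apply: he1; rewrite xy.
by apply: he2; rewrite xy.
Qed.

(** [rho] is a cluster point of starting points [u N] whose itineraries match [s] on growing
    windows. At a discontinuity of [f] the [u N] may approach from either side, so nothing is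
    claimed there. *)
Lemma coding_base (s : Sigma2) : coding s -> exists rho, forall i : int,
  locally_constant_at f (rho + i%:~R * alpha) -> s i = itinerary rho i.
Proof.
move=> /codingP cs.
have /choice[u hu] N : exists x, 0 <= x < 1 /\ agree N s (itinerary x).
  have [x hx] := cs N; exists (fpart x); rewrite fpart_itv itinerary_fpart.
  by split.
have u01 : (u @ \oo) `[0, 1]%classic.
  by exists 0%N => // n _ /=; rewrite in_itv/=; have [/andP[-> /ltW]] := hu n.
have [rho [_ cl]] := @segment_compact R 0 1 _ _ u01.
exists rho => i [e e0 he].
have [] := cl [set x | exists2 n, (`|i| <= n)%N & x = u n] (ball rho e).
- by exists `|i|%N => // n /= ni; exists n.
- exact: nbhsx_ballx.
move=> _ [[n ni ->]]; rewrite /ball/= => hb.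
have [_ /(_ i ni) ->] := hu n; rewrite /itinerary he//.
by rewrite distrC opprD addrACA subrr addr0.
Qed.

(** The orbit of the base point [rho] is steered strictly inside a right neighbourhood of [x] on
    which the itinerary is constant over the window. There [f] is locally constant at all times of
    the window, so the symbols of [s] are those of [rho]. *)
Lemma coding_orbit_approx (s : Sigma2) x N : coding s ->
  exists n, agree N (iter n shift_map s) (itinerary x).
Proof.
move=> cs; have [rho hrho] := coding_base cs.
have [e e0 he] := itinerary_right x N.
have e20 : 0 < e / 2 by rewrite divr_gt0.
have [K hK] := orbit_dense alpha_irr e20.
(* Aiming at the midpoint with tolerance [e / 2] lands strictly between [x] and [x + e]. *)
have [n [m [_ hn]]] := hK (x + e / 2 - rho); exists n.
have /andP[l1 l2] : x < rho + n%:R * alpha - m%:~R < x + e.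
  by move: hn; rewrite ltr_norml => /andP[h1 h2]; apply/andP; split; lra.
have pE (i : int) : rho + (i + n%:Z)%:~R * alpha =
    rho + n%:R * alpha - m%:~R + i%:~R * alpha + m%:~R.
  by rewrite intrD -pmulrn; ring.
move=> i iN; rewrite iter_shift_map hrho.
  rewrite {1}/itinerary pE periodic1_int// -/(itinerary _ i).
  by rewrite -[LHS]he// l2 ltW.
have fx z : x + i%:~R * alpha <= z < x + i%:~R * alpha + e ->
    f z = f (x + i%:~R * alpha).
  move=> /andP[h1 h2]; have := he (z - i%:~R * alpha) _ i iN.
  by rewrite /itinerary subrK => ->//; apply/andP; split; lra.
have [d d0 hd] : locally_constant_at f (rho + n%:R * alpha - m%:~R + i%:~R * alpha).
  by apply: (locally_constant_inside fx); apply/andP; split; lra.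
exists d => // y yd; rewrite pE periodic1_int//.
rewrite -[y](subrK m%:~R) periodic1_int// hd//.
by apply: le_lt_trans yd; rewrite pE le_eqVlt; apply/orP; left; apply/eqP;
  congr `|_|; ring.
Qed.

Lemma coding_minimal : minimal_system (subsystem_map coding_system).
Proof.
move=> y O [z Oz] [V oV VO].
have Vz : V (inclusion coding_system z) by move: Oz; rewrite -VO.
have [N hN] := nbhs_Sigma2 (open_nbhs_nbhs (conj oV Vz)).
have [x hx] := (codingP _).1 (inclusionP z) N.
have [n hn] := coding_orbit_approx x N (inclusionP y).
exists (iter n (subsystem_map coding_system) y); split; last by exists n; left.
rewrite -VO /=; apply: hN; rewrite -/(inclusion coding_system _) inclusion_iter.
exact: (agree_trans hx (agreeC hn)).
Qed.

End SymbolFunctions.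

(** * Unique ergodicity of codings *)

Section CircleMeasure.
Variable R : realType.
Local Notation leb := (@lebesgue_measure R).
Implicit Types (V : set R) (x y e a : R).

(* Openness in the Sorgenfrey topology. *)
Definition right_open V :=
  forall x, V x -> exists2 e, 0 < e & forall y, x <= y < x + e -> V y.

(* The right neighbourhoods of distinct boundary points are disjoint. *)
Lemma right_open_boundary V : right_open V -> countable (V `\` V^°).
Proof.
move=> ro; pose B := V `\` V^°.
have /choice[q hq] x : exists q : rat, B x ->
    x < ratr q /\ forall y, x < y -> y < ratr q -> V^° y.
  have [Bx|nBx] := pselect (B x); last by exists 0.
  have [e e0 he] := ro x Bx.1.
  have [q] := rat_in_itvoo (ltr_pwDr e0 (lexx x)).
  rewrite in_itv/= => /andP[xq qe]; exists q => _; split => // y xy yq.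
  have yI : y \in `]x, (ratr q)[ by rewrite in_itv/= xy.
  rewrite /interior; apply: filterS (near_in_itvoo yI) => /= z; rewrite in_itv/= => /andP[xz zq].
  by apply: he; rewrite ltW//= (lt_trans zq).
apply/countable_injP; exists (fun x => pickle (q x)) => x y.
rewrite !inE => Bx By /(pcan_inj pickleK) qxy.
have [xq hx] := hq _ Bx; have [yq hy] := hq _ By.
have [xy|yx|//] := ltgtP x y.
- by case: By => _ []; apply: hx => //; rewrite qxy.
- by case: Bx => _ []; apply: hy => //; rewrite -qxy.
Qed.

Lemma countable_set_measurable V : countable V -> measurable V.
Proof. by move=> cV; apply: countable_measurable cV => t; exact: measurable_set1. Qed.

Lemma interior_measurable V : measurable V^°.
Proof. by apply: open_measurable; exact: open_interior. Qed.

Lemma right_open_measurable V : right_open V -> measurable V.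
Proof.
move=> ro; have -> : V = V^° `|` (V `\` V^°).
  apply/seteqP; split=> [x Vx|x [/interior_subset//|[]//]].
  by have [] := pselect (V^° x); [left|right].
apply: measurableU; first exact: interior_measurable.
exact: countable_set_measurable (right_open_boundary _).
Qed.

Lemma measurable_translate V a : measurable V -> measurable [set x | V (x + a)].
Proof.
move=> mV; rewrite -[X in measurable X]setTI.
have mf : measurable_fun [set: R] (fun x => x + a) by exact: measurable_funD.
exact: mf.
Qed.

(** A translated measure gives half-open intervals their length, which characterizes Lebesgue
    measure. *)
Lemma lebesgue_measure_translate V a : measurable V ->
  leb [set x | V (x + a)] = leb V.
Proof.
move=> mV; have mf : measurable_fun [set: measurableTypeR R]
    (fun x => x + a : measurableTypeR R).
  exact: measurable_funD.
pose f : {mfun measurableTypeR R >-> measurableTypeR R} :=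
  HB.pack (fun x : measurableTypeR R => x + a : measurableTypeR R)
    (isMeasurableFun.Build _ _ _ _ _ mf).
apply/esym.
rewrite -[RHS]/(pushforward leb f V); apply: lebesgue_measure_unique => //= _ [[b c]] _ <-.
rewrite /pushforward.
have -> : f @^-1` [set` `](b, c).1, (b, c).2]] = `]b - a, c - a]%classic.
  by apply/seteqP; split=> z /=; rewrite !in_itv/= ltrBlDr lerBrDr.
rewrite !lebesgue_measure_itv/= !lte_fin ltrD2r.
by case: ifP => // _; rewrite -!EFinB; congr EFin; ring.
Qed.

Definition unit_interval : set R := `[0, 1[%classic.

Lemma unit_interval_measurable : measurable unit_interval.
Proof. exact: measurable_itv. Qed.

(** The circle appears as the line with its 1-periodic sets, and its measure as Lebesgue measure on
    the fundamental domain [0, 1). *)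
Definition circle_measure : set (measurableTypeR R) -> \bar R :=
  mrestr leb unit_interval_measurable.

HB.instance Definition _ := Measure.on circle_measure.

Lemma circle_measureT : circle_measure setT = 1%E.
Proof.
by rewrite /circle_measure /mrestr setTI lebesgue_measure_itv/= lte_fin ltr01 sube0.
Qed.

HB.instance Definition _ :=
  Measure_isProbability.Build _ _ _ circle_measure circle_measureT.

(** Rotating by [a] in [0, 1) amounts to measuring [V] on [a, 1 + a); the part beyond 1 is moved
    back by one period. *)
Lemma circle_measure_rotate V a : measurable V -> periodic1 V ->
  circle_measure [set x | V (x + a)] = circle_measure V.
Proof.
move=> mV pV; wlog /andP[a0 a1] : a / 0 <= a < 1.
  move=> h; rewrite -[RHS](h _ (fpart_itv a)); congr circle_measure.
  apply/seteqP; split=> x /=; rewrite /fpart addrA -intrN periodic1_int//.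
rewrite /circle_measure /mrestr.
have -> : [set x | V (x + a)] `&` unit_interval =
    [set x | (V `&` `[a, 1 + a[) (x + a)].
  by apply/seteqP; split=> x /=; rewrite /unit_interval/= !in_itv/= lerDr ltrD2r.
rewrite lebesgue_measure_translate; last exact: measurableI.
have -> : V `&` `[a, 1 + a[ = (V `&` `[a, 1[) `|` (V `&` `[1, 1 + a[).
  rewrite -setIUr; congr setI; apply/seteqP; split=> x /=; rewrite !in_itv/=.
    by move=> /andP[h1 h2]; case: (ltP x 1) => h; [left|right]; rewrite ?h1 ?h2.
  by move=> [/andP[h1 h2]|/andP[h1 h2]]; apply/andP; split; lra.
have -> : V `&` unit_interval = (V `&` `[a, 1[) `|` (V `&` `[0, a[).
  rewrite -setIUr; congr setI; apply/seteqP; split=> x /=; rewrite /unit_interval/= !in_itv/=.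
    by move=> /andP[h1 h2]; case: (ltP x a) => h; [right|left]; rewrite ?h1 ?h2.
  by move=> [/andP[h1 h2]|/andP[h1 h2]]; apply/andP; split; lra.
rewrite !measureU//; try exact: measurableI.
- congr (_ + _)%E.
  rewrite -[RHS](lebesgue_measure_translate (-1)); last exact: measurableI.
  have Vm1 x : V (x - 1) = V x by rewrite -(pV (x - 1)) subrK.
  congr leb; apply/seteqP; split=> x /=; rewrite !in_itv/= Vm1.
    by move=> [h1 /andP[h2 h3]]; split => //; apply/andP; split; lra.
  by move=> [h1 /andP[h2 h3]]; split => //; apply/andP; split; lra.
- apply/seteqP; split=> x //= [[_]]; rewrite in_itv/= => /andP[h1 _] [_].
  by rewrite in_itv/= => /andP[_ h2]; lra.
- apply/seteqP; split=> x //= [[_]]; rewrite in_itv/= => /andP[_ h1] [_].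
  by rewrite in_itv/= => /andP[h2 _]; lra.
Qed.

(** The difference is countable, hence null. The interior is exhausted by the points that have a
    ball of a given radius in [V], which is how frequencies reach [V]. *)
Lemma circle_measure_interior V : right_open V ->
  circle_measure V = circle_measure V^°.
Proof.
move=> ro; apply/eqP; rewrite eq_le; apply/andP; split; last first.
  apply: le_measure; rewrite ?inE; [exact: interior_measurable| |].
    exact: right_open_measurable.
  exact: interior_subset.
have mB : measurable (V `\` V^°).
  exact: countable_set_measurable (right_open_boundary _).
have mI : measurable V^° by exact: interior_measurable.
apply: (@le_trans _ _ (circle_measure (V^° `|` (V `\` V^°)))).
  apply: le_measure; rewrite ?inE; [exact: right_open_measurable| |].
    exact: measurableU.
  by move=> x Vx; have [] := pselect (V^° x); [left|right].
apply: le_trans (measureU2 _ _ _) _ => //=.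
rewrite [X in (_ + X)%E](_ : _ = 0%E) ?adde0//.
apply/eqP; rewrite eq_le measure_ge0 andbT.
rewrite -(countable_lebesgue_measure0 (right_open_boundary ro)).
 apply: le_measure.
- by rewrite inE; apply: measurableI => //; exact: unit_interval_measurable.
- by rewrite inE.
- exact: subIsetl.
Qed.

End CircleMeasure.

Section ProbabilitySums.
Context d (T : measurableType d) (R : realType) (P : probability T R).
Variables (A : nat -> set T) (N : nat) (c : R).
Hypothesis mA : forall k, measurable (A k).

Let sumE : (\sum_(k < N) P (A k) = \int[P]_t (\sum_(k < N) \1_(A k) t)%:E)%E.
Proof.
under [RHS]eq_integral do rewrite -sumEFin.
rewrite ge0_integral_sum//=.
- by apply: eq_bigr => k _; rewrite integral_indic// setIT.
- by move=> k; apply/measurable_EFinP; exact: measurable_indic.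
Qed.

Let msum : measurable_fun [set: T] (fun t => (\sum_(k < N) \1_(A k) t)%:E : \bar R).
Proof.
apply/measurable_EFinP; apply: measurable_sum => k; exact: measurable_indic.
Qed.

Let sum0 t : (0 <= (\sum_(k < N) \1_(A k) t)%:E :> \bar R)%E.
Proof. by rewrite lee_fin sumr_ge0. Qed.

Let cstE : (\int[P]_t (c%:E) = c%:E)%E.
Proof. by rewrite integral_cst//= probability_setT mule1. Qed.

(** Integrates a bound on the number of sets [A k] containing a point. It is applied with circle
    measure to rotated copies of a set, and its counterpart below with an invariant measure to
    iterated preimages. *)
Lemma probability_sum_le : (forall t, \sum_(k < N) \1_(A k) t <= c) ->
  (\sum_(k < N) P (A k) <= c%:E)%E.
Proof.
move=> h; rewrite sumE -cstE; apply: ge0_le_integral => //.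
  by move=> t _; rewrite lee_fin (le_trans _ (h t))// sumr_ge0.
Qed.

Lemma probability_sum_ge : 0 <= c -> (forall t, c <= \sum_(k < N) \1_(A k) t) ->
  (c%:E <= \sum_(k < N) P (A k))%E.
Proof.
move=> c0 h; rewrite sumE -cstE; apply: ge0_le_integral => //.
by move=> t _; rewrite lee_fin.
Qed.

End ProbabilitySums.

(** * Visits of the rotation to a set *)

Section Frequencies.
Variables (R : realType) (alpha : R).
Hypothesis alpha_irr : irrational alpha.
Local Notation m := (@circle_measure R).
Implicit Types (E : set R) (d x : R) (N : nat).

Definition visits E x N : R := \sum_(k < N) \1_E (x + k%:R * alpha).

(** The margin [d] absorbs the error in [orbit_dense]. The result is closed, hence measurable, for
    arbitrary [E]. *)
Definition inner E d : set R := [set x | forall z, `|z - x| < d -> E z].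

Lemma inner_measurable E d : measurable (inner E d).
Proof.
rewrite -[inner E d]setCK; apply: measurableC; apply: open_measurable.
have -> : ~` inner E d = \bigcup_(z in ~` E) ball z d.
  apply/seteqP; split=> x /=.
    by move=> /existsNP[z /not_implyP[zd nz]]; exists z.
  by move=> [z nz zd] /(_ z zd).
by apply: bigcup_open => z _; exact: ball_open.
Qed.

Lemma inner_periodic E d : periodic1 E -> periodic1 (inner E d).
Proof.
move=> pE x; apply/propext; split=> h z zx.
  by rewrite -pE; apply: h; rewrite opprD addrACA subrr addr0.
by rewrite -[z](subrK 1) pE; apply: h; rewrite -addrA -opprD [1 + x]addrC.
Qed.

Lemma inner_bigcup E : \bigcup_n inner E n.+1%:R^-1 = E^°.
Proof.
apply/seteqP; split=> x.
  move=> [n _ h]; apply/nbhs_ballP; exists n.+1%:R^-1 => /=; first by rewrite invr_gt0.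
  by move=> z; rewrite /ball/= distrC => /h.
move=> /nbhs_ballP[e /= e0 he]; exists (Num.trunc e^-1) => // z zx.
apply: he; rewrite /ball/= distrC; apply: lt_trans zx _.
rewrite -[ltRHS]invrK ltf_pV2 ?posrE ?invr_gt0//.
by have /andP[] := truncn_itv (ltW (etrans (invr_gt0 e) e0)).
Qed.

Lemma visits_add E x N K : visits E x (N + K) <= visits E x N + K%:R.
Proof.
rewrite /visits big_split_ord/= lerD2l.
rewrite -[K in leRHS]card_ord -sumr_const; apply: ler_sum => i _.
by rewrite indicE; case: (_ \in _).
Qed.

Lemma visits_drop E x N K : visits E (x + K%:R * alpha) N <= visits E x (N + K).
Proof.
rewrite /visits addnC big_split_ord/=; apply: (@le_trans _ _
  (\sum_(i < N) \1_E (x + (K + i)%:R * alpha))).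
  by apply: ler_sum => i _; rewrite natrD mulrDl addrA.
by rewrite lerDr sumr_ge0.
Qed.

(* Moving the starting point by [th] costs a bounded number of visits, so the
   visits from any point dominate their average over the circle. *)
Lemma visits_ge E d : periodic1 E -> 0 < d ->
  exists K : nat, forall N x,
    (N%:R%:E * m (inner E d) <= (visits E x N + K%:R)%:E)%E.
Proof.
move=> pE d0; have [K hK] := orbit_dense alpha_irr d0; exists K => N x.
have pI := @inner_periodic E d pE.
pose A (k : nat) := [set th | inner E d (th + (x + k%:R * alpha))].
have mA k : measurable (A k) by apply: measurable_translate; exact: inner_measurable.
have -> : (N%:R%:E * m (inner E d) = \sum_(k < N) m (A k))%E.
  rewrite (eq_bigr (fun=> m (inner E d))) => [|k _].
    by rewrite sumr_const card_ord mule_natl.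
  by rewrite /A circle_measure_rotate//; exact: inner_measurable.
apply: probability_sum_le => // th.
have [k0 [p [k0K hk0]]] := hK th.
apply: (@le_trans _ _ (visits E (x + k0%:R * alpha) N)).
  apply: ler_sum => k _; rewrite !indicE ler_nat.
  have [/set_mem h|//] := boolP (_ \in A _); rewrite mem_set//.
  rewrite -(periodic1_int (- p) _ pE); apply: h.
  rewrite -normrN; apply: le_lt_trans hk0; rewrite intrN le_eqVlt.
  by apply/orP; left; apply/eqP; congr `|_|; ring.
apply: (le_trans (visits_drop _ _ _ _)); apply: (le_trans (visits_add _ _ _ _)).
by rewrite lerD2l ler_nat ltnW.
Qed.

End Frequencies.

Lemma subsystem_map_continuous (X : topologicalType) (h : X -> X)
    (Y : subsystem h) : continuous h -> continuous (subsystem_map Y).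
Proof.
move=> hc; apply: continuous_comp_initial => y.
apply: (@continuous_comp _ _ _ (inclusion Y) h); last exact: hc.
exact: inclusion_continuous.
Qed.

Lemma subsystem_map_measurable (X : ptopologicalType) (h : X -> X)
    (Y : subsystem h) (A : set (borel (subspace_of Y))) : continuous h ->
  measurable A ->
  measurable (subsystem_map Y @^-1` A : set (borel (subspace_of Y))).
Proof.
move=> hc mA; rewrite -[X in measurable X]setTI.
apply: (@measurability _ _ (borel (subspace_of Y)) (borel (subspace_of Y))
  setT (subsystem_map Y) open) => //.
move=> _ [B oB <-]; rewrite setTI; apply: sub_sigma_algebra.
have /continuousP := subsystem_map_continuous (Y := Y) hc; exact.
Qed.

(** * Invariant measures of a coding *)

Section CodingMeasure.
Variables (R : realType) (alpha : R) (f : R -> bool).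
Hypothesis alpha_irr : irrational alpha.
Hypothesis f_per : periodic1 f.
Hypothesis f_rlc : right_locally_constant f.
Local Notation m := (@circle_measure R).
Local Notation Y := (coding_system alpha f).
Local Notation itin := (itinerary alpha f).

Definition itinerary_point (x : R) : subspace_of Y :=
  exist _ (itin x) (mem_set (@itinerary_coding _ alpha f x)).

Lemma itinerary_point_shift x :
  subsystem_map Y (itinerary_point x) = itinerary_point (x + alpha).
Proof. by apply: inclusion_inj; exact: shift_itinerary. Qed.

Definition itinerary_preimage (V : set Sigma2) : set R := [set x | V (itin x)].

Lemma itinerary_preimage_periodic V : periodic1 (itinerary_preimage V).
Proof. by move=> x; congr V; have := itineraryDint alpha f_per x 1. Qed.

Lemma itinerary_preimage_open V : open V -> right_open (itinerary_preimage V).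
Proof.
move=> oV x Vx; have [N hN] := nbhs_Sigma2 (open_nbhs_nbhs (conj oV Vx)).
have [e e0 he] := itinerary_right alpha f_rlc x N.
by exists e => // y /he /hN.
Qed.

Lemma itinerary_point_measurable :
  measurable_fun [set: measurableTypeR R]
    (itinerary_point : measurableTypeR R -> borel (subspace_of Y)).
Proof.
apply: (@measurability _ _ (measurableTypeR R) (borel (subspace_of Y)) _ _ open) => //.
move=> _ [_ [V oV <-] <-]; rewrite setTI.
by apply: right_open_measurable; exact: itinerary_preimage_open.
Qed.

Definition itinerary_mfun : {mfun measurableTypeR R >-> borel (subspace_of Y)} :=
  HB.pack (itinerary_point : measurableTypeR R -> borel (subspace_of Y))
    (isMeasurableFun.Build _ _ (measurableTypeR R) (borel (subspace_of Y)) _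
       itinerary_point_measurable).

Definition coding_measure : probability (borel (subspace_of Y)) R :=
  distribution m itinerary_mfun.

Lemma coding_measureE A : coding_measure A = m (itinerary_point @^-1` A).
Proof. by []. Qed.

Lemma coding_measure_invariant : is_invariant (subsystem_map Y) coding_measure.
Proof.
move=> A mA; rewrite !coding_measureE.
pose V : set R := itinerary_point @^-1` A.
have mV : measurable V.
  by rewrite -[V]setTI; exact: itinerary_point_measurable.
have pV : periodic1 V.
  move=> x; rewrite /V/=; congr A; apply: inclusion_inj.
  exact: (itineraryDint _ f_per x 1).
rewrite -[RHS](circle_measure_rotate alpha mV pV); congr (m _).
by apply/seteqP; split=> x /=; rewrite itinerary_point_shift.
Qed.

Lemma inclusion_open (V : set Sigma2) : open V ->
  measurable (inclusion Y @^-1` V : set (borel (subspace_of Y))).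
Proof. by move=> oV; apply: sub_sigma_algebra; exists V. Qed.

Definition window_set n (V : set Sigma2) :=
  forall s t, agree n s t -> V s -> V t.

Lemma window_set_open n V : window_set n V -> open V.
Proof.
by move=> wV; rewrite openE => s Vs; apply: filterS (nbhs_agree s n) => t /wV; exact.
Qed.

Lemma window_setC n V : window_set n V -> window_set n (~` V).
Proof. by move=> wV s t st nV Vt; apply: nV; apply: (wV t) => //; exact: agreeC. Qed.

Lemma invariant_iter (nu : probability (borel (subspace_of Y)) R) k
    (A : set (borel (subspace_of Y))) :
  is_invariant (subsystem_map Y) nu -> measurable A ->
  nu (iter k (subsystem_map Y) @^-1` A) = nu A.
Proof.
move=> inv; elim: k A => // k IH A mA.
rewrite -[RHS]inv// -[RHS]IH; last first.
  exact: (subsystem_map_measurable shift_map_continuous mA).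
by congr (nu _).
Qed.

Lemma iter_subsystem_map_measurable k (A : set (borel (subspace_of Y))) :
  measurable A ->
  measurable (iter k (subsystem_map Y) @^-1` A : set (borel (subspace_of Y))).
Proof.
elim: k A => // k IH A mA.
exact: (IH (subsystem_map Y @^-1` A) (subsystem_map_measurable shift_map_continuous mA)).
Qed.

(** A point of the coding follows an itinerary for [N] steps, so it visits [V] at least
    [N * m (inner E d) - K] times. Integrating against [nu] and letting [N] grow removes [K];
    letting [d] tend to 0 then reaches [m E], since [E] differs from its interior by a null set. *)
Lemma invariant_window_ge (nu : probability (borel (subspace_of Y)) R) n V :
  is_invariant (subsystem_map Y) nu -> window_set n V ->
  (m (itinerary_preimage V) <= nu (inclusion Y @^-1` V))%E.
Proof.
move=> inv wV; set E := itinerary_preimage V.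
have oV := window_set_open wV.
have mV := inclusion_open oV.
have pE : periodic1 E by exact: itinerary_preimage_periodic.
have nuV : nu (inclusion Y @^-1` V) = (fine (nu (inclusion Y @^-1` V)))%:E.
  by rewrite fineK// fin_num_measure.
have below d : 0 < d -> (m (inner E d) <= nu (inclusion Y @^-1` V))%E.
  move=> d0; have [K hK] := visits_ge alpha_irr pE d0.
  have mI : m (inner E d) = (fine (m (inner E d)))%:E.
    by rewrite fineK// fin_num_measure//; exact: inner_measurable.
  set u := fine (m _) in mI; set v := fine (nu _) in nuV.
  have bound N : N%:R * u <= N%:R * v + K%:R.
    rewrite -lerBlDr; have [neg|pos] := leP (N%:R * u - K%:R) 0.
      apply: (le_trans neg); rewrite mulr_ge0//.
      by rewrite -lee_fin -nuV measure_ge0.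
    rewrite -lee_fin; apply: (@le_trans _ _
      (\sum_(k < N) nu (iter k (subsystem_map Y) @^-1` (inclusion Y @^-1` V)))%E).
      apply: (@probability_sum_ge _ _ _ nu (fun k =>
        iter k (subsystem_map Y) @^-1` (inclusion Y @^-1` V)) N) => [k||y].
      - exact: iter_subsystem_map_measurable.
      - exact: ltW.
      (* Testing whether the first [N] iterates lie in [V] reads symbols up to index [n + N]. *)
      - have [x hx] := (codingP _ _ _).1 (inclusionP y) (n + N)%N.
      rewrite lerBlDr; have := hK N x.
      rewrite mI -EFinM lee_fin => /le_trans; apply; rewrite lerD2r.
      apply: ler_sum => k _; rewrite !indicE ler_nat.
      have [/set_mem h|//] := boolP (_ \in E); rewrite mem_set//=.
      rewrite inclusion_iter; apply: wV h => i iN.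
      have -> : itin (x + k%:R * alpha) i = itin x (i + k%:Z).
        by rewrite /itinerary intrD -pmulrn; congr f; ring.
      by rewrite iter_shift_map hx//; have := ltn_ord k; lia.
    rewrite (eq_bigr (fun=> v%:E)) => [|k _]; last first.
      by rewrite (invariant_iter _ inv mV) nuV.
    by rewrite sumr_const card_ord EFinM mule_natl.
  (* An excess [u - v] would outgrow the constant [K] once [N] exceeds [K / (u - v)]. *)
  rewrite mI nuV lee_fin leNgt; apply/negP => vu.
  have uv0 : 0 < u - v by rewrite subr_gt0.
  have := bound (Num.trunc (K%:R / (u - v))).+1.
  have := truncn_itv (divr_ge0 (ler0n _ K) (ltW uv0)).
  move=> /andP[_]; rewrite ltr_pdivrMr// => h1 h2.
  by rewrite -lerBlDl -mulrBr leNgt h1 in h2.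
have ndI : nondecreasing_seq (fun j => inner E j.+1%:R^-1).
  move=> i j ij; apply/subsetPset => x h z zx; apply: h; apply: (lt_le_trans zx).
  by rewrite lef_pV2 ?posrE// ler_nat.
have lim : m (inner E j.+1%:R^-1) @[j --> \oo] --> m E.
  rewrite circle_measure_interior; last exact: itinerary_preimage_open.
  rewrite -(inner_bigcup E); apply: nondecreasing_cvg_mu => //.
    by move=> j; exact: inner_measurable.
  by apply: bigcup_measurable => j _; exact: inner_measurable.
rewrite -(cvg_lim _ lim)//; apply: lime_le; first by apply/cvg_ex; exists (m E).
by near=> j; apply: below; rewrite invr_gt0.
Unshelve. all: by end_near. Qed.

(** The complement of a window set is again one, so the lower bound applied to it gives the upper
    bound. *)
Lemma invariant_window nu n V : is_invariant (subsystem_map Y) nu ->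
  window_set n V -> nu (inclusion Y @^-1` V) = m (itinerary_preimage V).
Proof.
move=> inv wV; have mV := inclusion_open (window_set_open wV).
have mE : measurable (itinerary_preimage V).
  by apply: right_open_measurable; exact/itinerary_preimage_open/(window_set_open wV).
have ge := invariant_window_ge inv wV.
apply/eqP; rewrite eq_le ge andbT.
have := invariant_window_ge inv (window_setC wV).
rewrite -[inclusion Y @^-1` _]/(~` (inclusion Y @^-1` V)).
rewrite -[itinerary_preimage (~` V)]/(~` (itinerary_preimage V)).
rewrite !probability_setC//.
rewrite -(fineK (fin_num_measure nu _ mV)) -(fineK (fin_num_measure m _ mE)).
rewrite -!EFinB !lee_fin lerD2l lerN2 => h.
by rewrite -(fineK (fin_num_measure m _ mE)) lee_fin.
Qed.

(** Open sets generate the Borel sets and are stable under intersection, so an open [V] suffices; it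
    is an increasing union of window sets. *)
Lemma invariant_measureE nu (A : set (borel (subspace_of Y))) :
  is_invariant (subsystem_map Y) nu -> measurable A -> nu A = coding_measure A.
Proof.
move=> inv mA.
apply: (@measure_unique _ R (borel (subspace_of Y)) (@open (subspace_of Y))
  (fun=> setT) _ _ _ _ nu coding_measure) => //.
- by move=> U V oU oV; exact: openI.
- by move=> _; exact: openT.
- by rewrite bigcup_const//; exists 0%N.
- move=> _ [V oV <-].
  pose W n : set Sigma2 := [set s | forall t, agree n s t -> V t].
  have wW n : window_set n (W n).
    by move=> s t st Ws u tu; apply: Ws; exact: agree_trans st tu.
  have VE : V = \bigcup_n W n.
    apply/seteqP; split=> [s Vs|s [n _]]; last exact.
    by have [n hn] := nbhs_Sigma2 (open_nbhs_nbhs (conj oV Vs)); exists n.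
  have ndW : nondecreasing_seq (fun n => inclusion Y @^-1` W n).
    move=> i j ij; apply/subsetPset => y Wy t yt; apply: Wy.
    exact: agreeW yt.
  have cvgW (mu : probability (borel (subspace_of Y)) R) :
      mu (inclusion Y @^-1` W n) @[n --> \oo] --> mu (inclusion Y @^-1` V).
    rewrite VE preimage_bigcup; apply: nondecreasing_cvg_mu => //.
      by move=> n; exact: (inclusion_open (window_set_open (wW n))).
    apply: bigcup_measurable => n _.
    exact: (inclusion_open (window_set_open (wW n))).
  rewrite -[LHS](cvg_lim _ (cvgW nu))// -[RHS](cvg_lim _ (cvgW coding_measure))//.
  congr (limn _); apply/funext => n.
  by rewrite !(invariant_window _ (wW n))//; exact: coding_measure_invariant.
- by move=> _; rewrite -ge0_fin_numE// fin_num_measure.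
Qed.

Lemma coding_strictly_ergodic : is_ergodic_set R Y.
Proof.
split; first exact: coding_minimal.
exists coding_measure; first exact: coding_measure_invariant.
by move=> nu inv A mA; exact: invariant_measureE.
Qed.

End CodingMeasure.

(** * The family of codings *)

Section BarSymbols.
Variable R : realType.
Implicit Types (x y z e : R) (t : nat -> R) (act : pred nat) (j : nat).

Definition gap j : R := 2^-1 ^+ j.+1.

Lemma gap_gt0 j : 0 < gap j. Proof. by rewrite exprn_gt0// invr_gt0. Qed.

Lemma gap0 : gap 0 = 1 / 2. Proof. by rewrite /gap expr1 mul1r. Qed.

Lemma gapS j : gap j = 2 * gap j.+1.
Proof. by rewrite /gap [in RHS]exprS mulrA divff ?mul1r. Qed.

Lemma gap_homo i j : (i <= j)%N -> gap j <= gap i.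
Proof.
move=> /subnK <-; elim: (j - i)%N => // k; apply: le_trans.
by rewrite addSn; have := gapS (k + i); have := gap_gt0 (k + i).+1; lra.
Qed.

Lemma gap_small e : 0 < e -> exists j, gap j < e.
Proof.
move=> e0; have := @cvg_expr R 2^-1.
have h : `|2^-1 : R| < 1 by rewrite gtr0_norm ?invr_gt0// invf_lt1// ltr1n.
move=> /(_ h) /cvgrPdist_lt /(_ e e0) [N _ hN]; exists N.
have := hN N.+1 (leqnSn N); rewrite /= sub0r normrN ger0_norm//.
Qed.

(** Block [j] has length [4 / 8 * gap j]. The bar starts a quarter of the way in and ends between
    one half and three quarters, so it never degenerates and leaves zeros at both ends of the
    block. *)
Definition bar_left j : R := 1 - 7 / 8 * gap j.

Definition bar_right j (u : R) : R := 1 - 6 / 8 * gap j + u * gap j / 8.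

Lemma bar_right_itv j u : 0 <= u <= 1 ->
  1 - 6 / 8 * gap j <= bar_right j u <= 1 - 5 / 8 * gap j.
Proof.
move=> /andP[u0 u1]; have g := gap_gt0 j; rewrite /bar_right; apply/andP; split.
  by rewrite lerDl divr_ge0// mulr_ge0// ltW.
suff : u * gap j <= gap j by lra.
by rewrite ler_piMl// ltW.
Qed.

(* Over one period: ones on [0, 1/2), the marker, and then for each active j a
   bar of ones in the block [1 - gap j, 1 - gap (j + 1)), whose right end moves
   affinely with t j. Blocks accumulate at 1 from the left only, which keeps the
   function right locally constant. *)
Definition bar_symbol act t x : bool :=
  (fpart x < 1 / 2) ||
  `[< exists2 j, act j & bar_left j <= fpart x < bar_right j (t j) >].

Lemma bar_symbol_periodic act t : periodic1 (bar_symbol act t).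
Proof. by move=> x; rewrite /bar_symbol -[1]/(1%:~R) fpartDint. Qed.

Lemma block_ex y : 1 / 2 <= y < 1 -> exists j, 1 - gap j <= y < 1 - gap j.+1.
Proof.
move=> /andP[y1 y2]; have ex : exists j, gap j < 1 - y.
  by apply: gap_small; rewrite subr_gt0.
case: (ex_minnP ex) => -[|j] h min; first by have := gap0; lra.
exists j; apply/andP; split; last by lra.
rewrite leNgt; apply/negP => ly.
by have /min : gap j < 1 - y by [lra]; rewrite ltnn.
Qed.

(** Here blocks are taken closed on the right, as suits limits from the left. *)
Lemma block_left_ex y : 1 / 2 < y < 1 -> exists j, 1 - gap j < y <= 1 - gap j.+1.
Proof.
move=> /andP[y1 y2]; have ex : exists j, gap j <= 1 - y.
  have [|j] := @gap_small (1 - y); first by rewrite subr_gt0.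
  by exists j; exact: ltW.
case: (ex_minnP ex) => -[|j] h min; first by have := gap0; lra.
exists j; apply/andP; split; last by lra.
rewrite ltNge; apply/negP => ly.
by have /min : gap j <= 1 - y by [lra]; rewrite ltnn.
Qed.

Section Values.
Variables (act : pred nat) (t : nat -> R).
Hypothesis t01 : forall j, 0 <= t j <= 1.

Lemma bar_symbol_marker y : 0 <= y < 1 / 2 -> bar_symbol act t y.
Proof.
move=> /andP[y0 y1]; rewrite /bar_symbol fpart_id ?y1//.
by rewrite y0; lra.
Qed.

(** The right end is allowed although it belongs to the next block: no bar reaches a block end, so
    both readings give [false]. *)
Lemma bar_symbol_block j y : 1 - gap j <= y <= 1 - gap j.+1 ->
  bar_symbol act t y = act j && (bar_left j <= y < bar_right j (t j)).
Proof.
move=> /andP[y1 y2]; have g := gap_gt0 j.+1; have gS := gapS j.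
have g0 : gap j <= 1 / 2 by rewrite -gap0 gap_homo.
rewrite /bar_symbol fpart_id; last by apply/andP; split; lra.
rewrite ltNge (_ : 1 / 2 <= y) //=; last by lra.
apply/asboolP/andP => [[i ai /andP[h1 h2]]|[aj h]]; last by exists j.
suff <- : i = j by rewrite ai h1 h2.
have /andP[b1 b2] := bar_right_itv i (t01 i).
rewrite /bar_left in h1; have gi := gap_gt0 i; have giS := gapS i.
have [ij|ji|//] := ltngtP i j.
- by exfalso; have := gap_homo ij; clear ij; lra.
- by exfalso; have := gap_homo ji; clear ji; lra.
Qed.

Lemma right_locally_constant_fpart (f : R -> bool) : periodic1 f ->
  (forall y, 0 <= y < 1 -> exists2 e, 0 < e &
     forall z, y <= z < y + e -> f z = f y) ->
  right_locally_constant f.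
Proof.
move=> fper h x; have [e e0 he] := h _ (fpart_itv x); exists e => // z /andP[z1 z2].
rewrite -(periodic1_int (- Num.floor x) x fper) intrN -/(fpart x).
rewrite -(periodic1_int (- Num.floor x) z fper) intrN; apply: he.
by rewrite /fpart; apply/andP; split; lra.
Qed.

Lemma bar_symbol_rlc : right_locally_constant (bar_symbol act t).
Proof.
apply: right_locally_constant_fpart; first exact: bar_symbol_periodic.
move=> y /andP[y0 y1]; have [ys|yl] := ltP y (1 / 2).
  exists (1 / 2 - y); first by rewrite subr_gt0.
  by move=> z /andP[z1 z2]; rewrite !bar_symbol_marker//; apply/andP; split; lra.
have [j /andP[b1 b2]] : exists j, 1 - gap j <= y < 1 - gap j.+1.
  by apply: block_ex; rewrite yl.
have red e : 0 < e -> e <= 1 - gap j.+1 - y ->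
    (forall z, y <= z < y + e -> act j ->
       (bar_left j <= z < bar_right j (t j)) = (bar_left j <= y < bar_right j (t j))) ->
    exists2 e, 0 < e &
     forall z, y <= z < y + e -> bar_symbol act t z = bar_symbol act t y.
  move=> e0 le h; exists e => // z zI; move: (zI) => /andP[z1 z2].
  rewrite !(@bar_symbol_block j); try by apply/andP; split; lra.
  by case: (boolP (act j)) => //= aj; rewrite h.
have /andP[r1 r2] := bar_right_itv j (t01 j).
have g := gap_gt0 j; have gS := gapS j.
have [yb|yb] := ltP y (bar_left j).
  apply: (red (bar_left j - y)); rewrite ?subr_gt0//.
    by rewrite /bar_left; lra.
  by move=> z /andP[z1 z2] _; rewrite !leNgt (_ : z < bar_left j); [rewrite yb|lra].
have [yr|yr] := ltP y (bar_right j (t j)).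
  apply: (red (bar_right j (t j) - y)); rewrite ?subr_gt0//; first by lra.
  move=> z /andP[z1 z2] _; rewrite yb yr; apply/andP; split; lra.
apply: (red (1 - gap j.+1 - y)); rewrite ?subr_gt0//.
move=> z /andP[z1 z2] _; rewrite yb /= [RHS]ltNge yr andbC.
by rewrite ltNge (le_trans yr z1).
Qed.

End Values.

Definition has_left_limits (f : R -> bool) :=
  forall x, exists b, exists2 e, 0 < e & forall z, x - e < z < x -> f z = b.

(** Within a period only 1 can fail to have a left limit, as blocks accumulate there; finitely many
    active bars leave the interval from [1 - gap n] to 1 free of ones. *)
Lemma bar_symbol_left_limits act t n : (forall j, 0 <= t j <= 1) ->
  (forall j, act j -> (j < n)%N) -> has_left_limits (bar_symbol act t).
Proof.
(* This integer brings [x] into (0, 1], not [0, 1), so that small left neighbourhoods of [y] stay in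
   one period. *)
move=> t01 actn x; pose m : int := 1 + Num.floor (- x).
pose y := x + m%:~R.
have /andP[y0 y1] : 0 < y <= 1.
  have /andP[] := fpart_itv (- x); rewrite /fpart /y /m intrD => h1 h2.
  by apply/andP; split; lra.
suff [b [e e0 he]] : exists b, exists2 e, 0 < e &
    forall z, y - e < z < y -> bar_symbol act t z = b.
  exists b, e => // z /andP[z1 z2].
  rewrite -(periodic1_int m z (bar_symbol_periodic act t)); apply: he.
  by rewrite /y; apply/andP; split; lra.
have [ys|yl] := leP y (1 / 2).
  exists true, y => // z /andP[z1 z2]; apply: bar_symbol_marker.
  by apply/andP; split; lra.
have [y1'|y1'] := ltP y 1; last first.
- exists false, (gap n); first exact: gap_gt0.
  move=> z /andP[z1 z2]; have zn : z <= 1 by lra.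
  have g0 : gap n <= 1 / 2 by rewrite -gap0 gap_homo.
  have [j /andP[j1 j2]] : exists j, 1 - gap j <= z < 1 - gap j.+1.
    by apply: block_ex; apply/andP; split; lra.
  rewrite (@bar_symbol_block _ _ t01 j); last by rewrite j1 ltW.
  case: (boolP (act j)) => //= /actn jn.
  by have := gap_homo jn; clear jn; lra.
have [j /andP[b1 b2]] : exists j, 1 - gap j < y <= 1 - gap j.+1.
  by apply: block_left_ex; rewrite yl.
have red b e : 0 < e -> e <= y - (1 - gap j) ->
    (forall z, y - e < z < y -> (bar_left j <= z < bar_right j (t j)) = b) ->
    exists b, exists2 e, 0 < e &
     forall z, y - e < z < y -> bar_symbol act t z = b.
  move=> e0 le h; exists (act j && b), e => // z zI; move: (zI) => /andP[z1 z2].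
  rewrite (@bar_symbol_block _ _ t01 j); last by apply/andP; split; lra.
  by rewrite h.
have /andP[r1 r2] := bar_right_itv j (t01 j).
have g := gap_gt0 j; have gS := gapS j.
have [yb|yb] := leP y (bar_left j).
  apply: (red false (y - (1 - gap j))); rewrite ?subr_gt0//.
  by move=> z /andP[z1 z2]; rewrite leNgt (lt_le_trans z2 yb).
have [yr|yr] := leP y (bar_right j (t j)).
  apply: (red true (y - bar_left j)); rewrite ?subr_gt0//.
    by rewrite /bar_left; lra.
  by move=> z /andP[z1 z2]; apply/andP; split; lra.
apply: (red false (y - bar_right j (t j))); rewrite ?subr_gt0//; first by lra.
by move=> z /andP[z1 z2]; rewrite andbC ltNge (_ : bar_right j (t j) <= z) //; lra.
Qed.

(** The value is [false] at every [1 - gap j], from 1/2 up to points near 1. For [r] strictly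
    between 0 and 1, subtracting [r] brings one of these zeros into the marker, a contradiction.
    Once [r = 0], the right ends of the bars can be compared. *)
Lemma bar_symbol_rigid act t t' rho :
  (forall j, 0 <= t j <= 1) -> (forall j, 0 <= t' j <= 1) ->
  (forall u, bar_symbol act t u = bar_symbol act t' (u + rho)) ->
  (exists m : int, rho = m%:~R) /\ forall j, act j -> t j = t' j.
Proof.
move=> t01 t01' eqf; set r := fpart rho.
have eqr u : bar_symbol act t u = bar_symbol act t' (u + r).
  rewrite eqf -(periodic1_int (- Num.floor rho) _ (bar_symbol_periodic act t')).
  by rewrite intrN addrA.
have zero j t1 : (forall j, 0 <= t1 j <= 1) -> bar_symbol act t1 (1 - gap j) = false.
  move=> t101; have g := gap_gt0 j; have gS := gapS j.
  rewrite (@bar_symbol_block _ _ t101 j); last by apply/andP; split; lra.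
  by rewrite /bar_left andbCA (_ : _ <= _ = false)//; apply/negbTE; rewrite -ltNge; lra.
have r0 : r = 0.
  have /andP[ge0 lt1] : 0 <= r < 1 := fpart_itv rho.
  apply/eqP; rewrite eq_le ge0 andbT leNgt; apply/negP => pos.
  (* For small [r] the zero [1 - gap 0 = 1 / 2] already falls into the marker; for larger [r] a zero
     nearer to 1 is taken. *)
  have [rs|rl] := ltP r (1 / 2).
    have := eqr (1 - gap 0 - r); rewrite subrK zero// gap0 bar_symbol_marker//.
    by apply/andP; split; lra.
  have [j gj] := @gap_small (1 - r) (ltac:(by rewrite subr_gt0)).
  have := eqr (1 - gap j - r); rewrite subrK zero// bar_symbol_marker//.
  by have := gap_gt0 j; move=> ?; apply/andP; split; lra.
have eq0 u : bar_symbol act t u = bar_symbol act t' u by rewrite eqr r0 addr0.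
split; first by exists (Num.floor rho); move: r0; rewrite /r /fpart; lra.
have half t1 t2 j : (forall j, 0 <= t1 j <= 1) -> (forall j, 0 <= t2 j <= 1) ->
    (forall u, bar_symbol act t1 u = bar_symbol act t2 u) -> act j -> t2 j <= t1 j.
  move=> h1 h2 eq12 aj; rewrite leNgt; apply/negP => lt12.
  have /andP[b1 b2] := bar_right_itv j (h1 j).
  have g := gap_gt0 j; have gS := gapS j.
  (* At the end of the shorter bar only the longer one still gives [true]. *)
  have := eq12 (bar_right j (t1 j)).
  rewrite !(@bar_symbol_block _ _ _ j)//; try by apply/andP; split; lra.
  rewrite ltxx andbF aj/= => /esym/andP[].
  by rewrite /bar_left; split; [lra|rewrite /bar_right ltrD2l ltr_pM2r// ltr_pM2r].
by move=> j aj; apply/eqP; rewrite eq_le !half.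
Qed.

End BarSymbols.

(** * Continuous dependence of the measure on the parameters *)

Section BoundedIntegrals.
Context d (T : measurableType d) (R : realType) (P : probability T R).

Lemma bounded_integrable (g : T -> R) (M : R) : measurable_fun setT g ->
  (forall x, `|g x| <= M) -> P.-integrable setT (EFin \o g).
Proof.
move=> mg hM; apply: measurable_bounded_integrable => //.
  by rewrite -ge0_fin_numE// fin_num_measure.
exists M; split; first exact: num_real.
by move=> r Mr x _; exact: le_trans (hM x) (ltW Mr).
Qed.

Lemma Rintegral_sub_bound (g1 g2 : T -> R) (A : set T) (M e : R) :
  measurable_fun setT g1 -> measurable_fun setT g2 -> measurable A -> 0 <= M ->
  (forall x, `|g1 x| <= M) -> (forall x, `|g2 x| <= M) ->
  (forall x, ~ A x -> `|g1 x - g2 x| <= e) -> 0 <= e ->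
  `| \int[P]_x g1 x - \int[P]_x g2 x | <= e + 2 * M * fine (P A).
Proof.
move=> m1 m2 mA M0 h1 h2 he e0.
have i1 := bounded_integrable m1 h1; have i2 := bounded_integrable m2 h2.
have m12 : measurable_fun setT (fun x => g1 x - g2 x) by exact: measurable_funB.
have h12 x : `|g1 x - g2 x| <= 2 * M.
  by apply: le_trans (ler_normB _ _) _; have := h1 x; have := h2 x; lra.
have iA : P.-integrable setT (EFin \o (fun x => e + 2 * M * \1_A x)).
  apply: (@bounded_integrable _ (e + 2 * M)).
    apply: measurable_funD; first exact: measurable_cst.
    by apply: measurable_funM; [exact: measurable_cst|exact: measurable_indic].
  move=> x; rewrite indicE; case: (_ \in _) => /=; rewrite ger0_norm; lra.
rewrite -RintegralB//; apply: le_trans (le_normr_Rintegral _ _) _ => //.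
  exact: bounded_integrable h12.
have -> : e + 2 * M * fine (P A) = \int[P]_x (e + 2 * M * \1_A x).
  rewrite RintegralD//; last 2 first.
  - exact: finite_measure_integrable_cst.
  - apply: (@bounded_integrable _ (2 * M)).
      by apply: measurable_funM; [exact: measurable_cst|exact: measurable_indic].
    by move=> x; rewrite indicE; case: (_ \in _) => /=; rewrite ger0_norm; lra.
  rewrite RintegralZl//; last exact: integrable_indic.
  rewrite Rintegral_cst//= probability_setT mulr1; congr (_ + _ * _).
  by rewrite /Rintegral integral_indic// setIT.
apply: le_Rintegral => //.
  apply: (@bounded_integrable _ (2 * M)); last by move=> x; rewrite normr_id.
  exact: measurableT_comp.
move=> x _; rewrite indicE; have [xA|/negP xA] := boolP (x \in A).
  by rewrite mulr1; have := h12 x; lra.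
by rewrite mulr0 addr0; apply: he => Ax; apply: xA; rewrite inE.
Qed.

End BoundedIntegrals.

Section SigmaFunctions.
Variable R : realType.
Variable F : Sigma2 -> R.
Hypothesis F_cont : continuous F.

Lemma Sigma2_bounded : exists2 M, 0 <= M & forall s, `|F s| <= M.
Proof.
have := continuous_compact (continuous_subspaceT F_cont) Sigma2_compact.
move=> /compact_bounded[M [_ hM]]; exists (`|M| + 1); first by rewrite addr_ge0.
move=> s; apply: (hM (`|M| + 1)); last by exists s.
by rewrite ltr_pwDr// ler_norm.
Qed.

(** Uniform continuity by compactness: pairs violating it would cluster at a point where [F] is
    discontinuous. *)
Lemma Sigma2_uniform e : 0 < e ->
  exists N, forall s t, agree N s t -> `|F s - F t| <= e.
Proof.
move=> e0; apply: contrapT => /forallNP h.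
have /choice[u hu] N : exists st : Sigma2 * Sigma2,
    agree N st.1 st.2 /\ e < `|F st.1 - F st.2|.
  have /existsNP[s /existsNP[t /not_implyP[st /negP]]] := h N.
  by rewrite -ltNge => est; exists (s, t).
have [s [_ cl]] := @Sigma2_compact ((fun n => (u n).1) @ \oo) _ filterT.
have /cvgrPdist_lt/(_ (e / 2)) := @F_cont s.
rewrite divr_gt0// => /(_ isT) /nbhs_Sigma2[N hN].
have [] := cl [set t | exists2 n, (N <= n)%N & t = (u n).1] [set t | agree N s t].
- by exists N => // n /= Nn; exists n.
- exact: nbhs_agree.
move=> _ [[n Nn ->] sn]; have [st] := hu n.
have h1 := hN _ sn; have h2 := hN _ (agree_trans sn (agreeW Nn st)).
rewrite ltNge => /negP; apply.
have -> : F (u n).1 - F (u n).2 = (F s - F (u n).2) - (F s - F (u n).1) by ring.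
by apply: le_trans (ler_normB _ _) _; rewrite /= in h1 h2; lra.
Qed.

Lemma Sigma2_measurable_fun :
  measurable_fun [set: borel Sigma2] (F : borel Sigma2 -> R).
Proof.
apply: (measurability _ (RGenOInfty.measurableE R)) => //.
move=> _ [_ [x ->] <-]; rewrite setTI; apply: sub_sigma_algebra.
by move/continuousP : F_cont; apply; exact: rray_open.
Qed.

End SigmaFunctions.

Section CodingIntegrals.
Variables (R : realType) (alpha : R).
Hypothesis alpha_irr : irrational alpha.
Local Notation m := (@circle_measure R).

Definition admissible (f : R -> bool) := periodic1 f /\ right_locally_constant f.

Definition coding_point (f : R -> bool) (fA : admissible f) : ergodic_sets R shift_map :=
  exist _ (coding_system alpha f)
    (mem_set (coding_strictly_ergodic alpha_irr fA.1 fA.2)).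

Lemma itinerary_measurable (f : R -> bool) : admissible f ->
  measurable_fun [set: measurableTypeR R]
    (itinerary alpha f : measurableTypeR R -> borel Sigma2).
Proof.
move=> [_ frlc].
apply: (@measurability _ _ (measurableTypeR R) (borel Sigma2) _ _ open) => //.
move=> _ [V oV <-]; rewrite setTI.
by apply: right_open_measurable; exact: itinerary_preimage_open.
Qed.

(** [extended_measure] rests on a measure obtained by choice; unique ergodicity identifies it with
    the law of the itinerary of a random point of the circle. *)
Lemma coding_integral (f : R -> bool) (fA : admissible f) (F : Sigma2 -> R) :
  continuous F ->
  \int[extended_measure (coding_point fA)]_x F x
    = \int[m]_x F (itinerary alpha f x).
Proof.
move=> Fc; have mi := itinerary_measurable fA.
rewrite /Rintegral; congr fine.
pose i : {mfun measurableTypeR R >-> borel Sigma2} :=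
  HB.pack (itinerary alpha f : measurableTypeR R -> borel Sigma2)
    (isMeasurableFun.Build _ _ (measurableTypeR R) (borel Sigma2) _ mi).
rewrite (@eq_measure_integral _ _ _ _ (distribution m i)).
  rewrite integral_pushforward//.
    by apply/measurable_EFinP; exact: Sigma2_measurable_fun.
  have [M _ hM] := Sigma2_bounded Fc.
  apply: (@bounded_integrable _ _ _ _ _ M) => [|x]; last exact: hM.
  exact: measurableT_comp (Sigma2_measurable_fun Fc) mi.
move=> A mA _.
have mYA : measurable (inclusion (coding_system alpha f) @^-1` A :
    set (borel (subspace_of (coding_system alpha f)))).
  by rewrite -[X in measurable X]setTI; exact: inclusion_measurable.
have inv := s2valP (cid2 (set_valP (coding_point fA)).2).
exact: (invariant_measureE alpha_irr fA.1 fA.2 inv mYA).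
Qed.

Lemma disagree_set_measurable (f f' : R -> bool) :
  admissible f -> admissible f' -> measurable [set x | f x <> f' x].
Proof.
move=> [_ frlc] [_ frlc']; apply: right_open_measurable => x Bx.
have [e e0 he] := frlc x; have [e' e0' he'] := frlc' x.
exists (Num.min e e'); first by rewrite lt_min e0.
move=> y; rewrite -ltrBlDl lt_min !ltrBlDl => /andP[xy /andP[ye ye']].
by rewrite /= he ?xy// he' ?xy.
Qed.

(** Disagreement on the window means that one of [2 * N + 1] rotated starting points lies where [f]
    and [f'] differ, and rotations preserve the measure. *)
Lemma disagree_measure (f f' : R -> bool) N : admissible f -> admissible f' ->
  let D := [set x | ~ agree N (itinerary alpha f x) (itinerary alpha f' x)] in
  measurable D /\ (m D <= (2 * N).+1%:R%:E * m [set x | f x <> f' x])%E.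
Proof.
move=> fA fA'; have [[fp _] [fp' _]] := (fA, fA').
pose B : set R := [set x | f x <> f' x].
have mB : measurable B by exact: disagree_set_measurable.
have pB : periodic1 B by move=> x; rewrite /B/= fp fp'.
pose b (i : int) : set R := [set x | B (x + i%:~R * alpha)].
have mb i : measurable (b i) by exact: measurable_translate.
have mbE i : m (b i) = m B by exact: circle_measure_rotate.
elim: N => [|N [mD IH]] /=.
  have -> : [set x | ~ agree 0 (itinerary alpha f x) (itinerary alpha f' x)] = b 0.
    apply/seteqP; split=> x /= h.
      move=> e; apply: h => i; rewrite leqn0 absz_eq0 => /eqP ->; exact: e.
    by move=> /(_ 0 (leqnn _)) e; apply: h.
  by rewrite mbE mul1e.
have -> : [set x | ~ agree N.+1 (itinerary alpha f x) (itinerary alpha f' x)] =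
  [set x | ~ agree N (itinerary alpha f x) (itinerary alpha f' x)] `|`
  (b N.+1 `|` b (- N.+1%:Z)).
  apply/seteqP; split=> x /=.
    move=> h; apply: contrapT => /not_orP[/contrapT h1 /not_orP[/contrapT h2 /contrapT h3]].
    apply: h => i; rewrite leq_eqVlt => /orP[/eqP iN|]; last exact: h1.
    by have [->|->] : i = N.+1 \/ i = - N.+1%:Z by lia.
  move=> [h|[h|h]] e; apply: h.
  - exact: agreeW e.
  - by apply: (e N.+1); lia.
  - by apply: (e (- N.+1%:Z)); lia.
split; first by apply: measurableU => //; exact: measurableU.
apply: le_trans (measureU2 m mD (measurableU _ _ (mb N.+1) (mb (- N.+1%:Z)))) _.
have -> : ((2 * N.+1).+1%:R%:E * m B = (2 * N).+1%:R%:E * m B + (m B + m B))%E.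
  rewrite -(fineK (fin_num_measure m _ mB)) -!EFinM -!EFinD; congr EFin.
  have -> : (2 * N.+1).+1 = ((2 * N).+1 + 2)%N by lia.
  by rewrite natrD; ring.
apply: leeD => //; apply: le_trans (measureU2 m (mb _) (mb _)) _.
by rewrite le_eqVlt; apply/orP; left; apply/eqP; congr (_ + _)%E; exact: mbE.
Qed.

(** Up to [e], [F] reads finitely many symbols. The constant [C] is chosen before [f] and [f'],
    hence serves all pairs at once. *)
Lemma coding_integral_close (F : Sigma2 -> R) e : continuous F -> 0 < e ->
  exists2 C, 0 <= C & forall (f f' : R -> bool), admissible f -> admissible f' ->
    `| \int[m]_x F (itinerary alpha f x) - \int[m]_x F (itinerary alpha f' x) |
      <= e + C * fine (m [set x | f x <> f' x]).
Proof.
move=> Fc e0; have [M M0 hM] := Sigma2_bounded Fc.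
have [N hN] := Sigma2_uniform Fc e0.
exists (2 * M * (2 * N).+1%:R); first by rewrite !mulr_ge0.
move=> f f' fA fA'; have [mD hD] := disagree_measure N fA fA'.
have mF g : admissible g -> measurable_fun setT (fun x => F (itinerary alpha g x)).
  by move=> gA; exact: measurableT_comp (Sigma2_measurable_fun Fc) (itinerary_measurable gA).
pose D := [set x | ~ agree N (itinerary alpha f x) (itinerary alpha f' x)].
have := @Rintegral_sub_bound _ (measurableTypeR R) R m _ _ D M e (mF f fA) (mF f' fA') mD M0.
move=> /(_ (fun=> hM _) (fun=> hM _) _ (ltW e0)) h; apply: le_trans (h _) _.
  by move=> x /contrapT Dx; exact: hN.
rewrite lerD2l -!mulrA !ler_wpM2l//.
have mB : measurable [set x | f x <> f' x].
  exact: (disagree_set_measurable fA fA').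
by rewrite -lee_fin EFinM !fineK// fin_num_measure.
Qed.

End CodingIntegrals.

Section BarSymbolContinuity.
Variables (R : realType) (act : pred nat).
Local Notation leb := (@lebesgue_measure R).
Local Notation m := (@circle_measure R).
Implicit Types (t : nat -> R).

Lemma bar_symbol_admissible t : (forall j, 0 <= t j <= 1) ->
  admissible (bar_symbol act t).
Proof. by split; [exact: bar_symbol_periodic|exact: bar_symbol_rlc]. Qed.

(** In the product topology only finitely many parameters can be kept close, so the blocks from [J]
    on are given up; they fill a final interval of length [gap J]. *)
Lemma bar_symbol_disagree t t' J :
  (forall j, 0 <= t j <= 1) -> (forall j, 0 <= t' j <= 1) ->
  (m [set x | bar_symbol act t x <> bar_symbol act t' x] <=
    (\sum_(j < J) `|t j - t' j| + gap R J)%:E)%E.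
Proof.
move=> t01 t01'; set D := [set x | _].
have mD : measurable D.
  exact: disagree_set_measurable (bar_symbol_admissible t01) (bar_symbol_admissible t01').
pose W n : set R := D `&` `[0, 1 - gap R n[%classic.
have mW n : measurable (W n) by apply: measurableI.
have leW n : (leb (W n) <= (\sum_(j < n) `|t j - t' j|)%:E)%E.
  elim: n => [|n IH].
    rewrite big_ord0 (_ : W 0 = set0) ?measure0//; apply/seteqP; split=> // x [].
    rewrite /D/= in_itv/= gap0 => h /andP[x0 x1]; apply: h.
    by rewrite !bar_symbol_marker//; apply/andP; split; lra.
  set a := bar_right n (t n); set b := bar_right n (t' n).
  (* Within block [n] the two functions differ at most between the two right ends. *)
  apply: (@le_trans _ _ (leb (W n `|` `[Num.min a b, Num.max a b[%classic))).
    apply: le_measure.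
    - by rewrite inE; exact: mW.
    - by rewrite inE; exact: (measurableU _ _ (mW n) (measurable_itv _)).
    - move=> x []; rewrite /D/= in_itv/= => h /andP[x0 x1].
    have [xn|xn] := ltP x (1 - gap R n).
      by left; split => //=; rewrite in_itv/= x0.
    right; rewrite in_itv/=; apply: contrapT => /negP; rewrite negb_and -ltNge -leNgt.
    move=> out; apply: h; rewrite !(@bar_symbol_block _ _ _ _ n)//; try by rewrite xn ltW.
    case: (act n) => //=; case: (bar_left R n <= x) => //=.
    rewrite -/a -/b; case/orP: out; rewrite ?lt_min ?ge_max => /andP[xa xb].
      by rewrite xa xb.
    by rewrite !ltNge xa xb.
  apply: le_trans (measureU2 leb (mW n) _) _ => //.
  rewrite big_ord_recr/= EFinD; apply: leeD => //.
  rewrite lebesgue_measure_itv/= lte_fin; case: ifP => _; last by rewrite lee_fin.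
  rewrite -EFinB lee_fin.
  have -> : Num.max a b - Num.min a b = `|a - b|.
    have [ab|ba] := leP a b; first by rewrite distrC ger0_norm// subr_ge0.
    by rewrite gtr0_norm// subr_gt0.
  have -> : a - b = (t n - t' n) * (gap R n / 8) by rewrite /a /b /bar_right; ring.
  rewrite normrM ler_piMr// ger0_norm; last by rewrite divr_ge0// ltW// gap_gt0.
  by have := gap_homo R (leq0n n); rewrite gap0; lra.
apply: (@le_trans _ _ (leb (W J `|` `[1 - gap R J, 1[%classic))).
  apply: le_measure.
  - by rewrite inE; apply: measurableI => //; exact: unit_interval_measurable.
  - by rewrite inE; exact: (measurableU _ _ (mW J) (measurable_itv _)).
  - move=> x [Dx]; rewrite /unit_interval/= in_itv/= => /andP[x0 x1].
    have [xJ|xJ] := ltP x (1 - gap R J); last by right; rewrite /= in_itv/= xJ.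
    by left; split => //=; rewrite in_itv/= x0.
apply: le_trans (measureU2 leb (mW J) _) _ => //.
rewrite EFinD; apply: leeD; first exact: leW.
rewrite /= lebesgue_measure_itv/= lte_fin; case: ifP => _; last first.
  by rewrite lee_fin ltW// gap_gt0.
by rewrite -EFinB lee_fin opprB addrCA subrr addr0.
Qed.

Variables (alpha : R) (alpha_irr : irrational alpha).
Variables (T : topologicalType) (p : T -> nat -> R).
Hypothesis p01 : forall x j, 0 <= p x j <= 1.
Hypothesis p_cont : forall j, continuous (fun x => p x j).

Definition bar_point (x : T) : ergodic_sets R shift_map :=
  coding_point alpha_irr (bar_symbol_admissible (p01 x)).

Lemma bar_param_near (x : T) J e : 0 < e ->
  \forall y \near x, \sum_(j < J) `|p x j - p y j| < e.
Proof.
elim: J e => [|J IH] e e0; first by apply: nearW => y; rewrite big_ord0.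
have e20 : 0 < e / 2 by rewrite divr_gt0.
have /cvgrPdist_lt/(_ _ e20) pJ := @p_cont J x.
apply: filterS (filterI (IH _ e20) pJ) => y [/= h1 h2].
by rewrite big_ord_recr/=; lra.
Qed.

Lemma bar_point_continuous : continuous bar_point.
Proof.
apply: continuous_comp_initial; apply: continuous_comp_initial => x.
apply/cvg_sup => F; apply: (@continuous_comp_initial _ T _ _ _ _ x) => {}x.
rewrite /comp /=.
apply/cvgrPdist_lt => e e0.
have e40 : 0 < e / 4 by rewrite divr_gt0.
have Fc : continuous F by exact: cts_fun.
have [C C0 hC] := coding_integral_close alpha Fc e40.
(* The sum of the parameter differences and the tail [gap J] are each below this bound, so together
   they contribute at most [e / 2]; the [+ 1] allows [C = 0]. *)
have d0 : 0 < e / (4 * (C + 1)) by rewrite divr_gt0// mulr_gt0// ltr_pwDr.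
have [J hJ] := @gap_small R _ d0.
apply: filterS (bar_param_near x J d0) => y hy.
rewrite /integrals /= !coding_integral//.
have := hC _ _ (bar_symbol_admissible (p01 x)) (bar_symbol_admissible (p01 y)).
move=> /le_lt_trans; apply.
set D := [set _ | _]; have mD : measurable D.
  exact: disagree_set_measurable (bar_symbol_admissible _) (bar_symbol_admissible _).
have : fine (m D) <= 2 * (e / (4 * (C + 1))).
  rewrite -lee_fin fineK ?fin_num_measure//.
  apply: le_trans (bar_symbol_disagree J (p01 x) (p01 y)) _.
  by rewrite lee_fin; lra.
move=> h; have h2 : C * fine (m D) <= (C + 1) * (2 * (e / (4 * (C + 1)))).
  by apply: ler_pM => //; [rewrite fine_ge0|lra].
have C1 : C + 1 != 0 by rewrite gt_eqF// ltr_pwDr.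
have E : (C + 1) * (2 * (e / (4 * (C + 1)))) = e / 2 by field.
by lra.
Qed.

End BarSymbolContinuity.

(** * The embedding *)

Section CompactHomeomorphisms.

Lemma compact_hausdorff_homeomorphism (K T : topologicalType) (phi : K -> T) :
  compact [set: K] -> hausdorff_space T -> continuous phi -> injective phi ->
  (forall y, exists x, phi x = y) -> homeomorphism phi.
Proof.
move=> cK hT phic phi_inj /choice[g gK]; exists g.
have Kg : cancel phi g by move=> x; apply: phi_inj; rewrite gK.
split=> //; apply/continuous_closedP => C closedC.
have -> : g @^-1` C = phi @` C.
  apply/seteqP; split=> [y Cy|_ [x Cx <-]]; first by exists (g y); rewrite ?gK.
  by rewrite /= Kg.
apply: compact_closed => //; apply: continuous_compact.
  exact: continuous_subspaceT.
exact: (subclosed_compact closedC cK).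
Qed.

Lemma separated_hausdorff (R : realType) (T : topologicalType) :
  (forall p q : T, p <> q -> exists2 G : T -> R, continuous G & G p <> G q) ->
  hausdorff_space T.
Proof.
move=> sep p q cl; apply: contrapT => /sep[G Gc] /eqP; rewrite -subr_eq0 => Gpq.
have d0 : 0 < `|G p - G q| / 2 by rewrite divr_gt0// normr_gt0.
have /cvgrPdist_lt/(_ _ d0) np := @Gc p.
have /cvgrPdist_lt/(_ _ d0) nq := @Gc q.
have [z [/= hp hq]] := cl _ _ np nq.
have := ler_normB (G p - G z) (G q - G z).
have -> : G p - G z - (G q - G z) = G p - G q by ring.
by lra.
Qed.

(** Separating functions make the image Hausdorff and [phi] injective at once, so nothing has to be
    known about [T] away from the image. *)
Lemma compact_embedding (R : realType) (K T : topologicalType) (phi : K -> T) :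
  compact [set: K] -> continuous phi ->
  (forall p q : K, p <> q ->
     exists2 G : T -> R, continuous G & G (phi p) <> G (phi q)) ->
  contains_copy T K.
Proof.
move=> cK phic sep; exists (range phi).
have phiA x : phi x \in range phi by rewrite inE; exists x.
exists (fun x => exist _ (phi x) (phiA x)).
apply: compact_hausdorff_homeomorphism => //.
- apply: (@separated_hausdorff R) => -[a aA] [b bA] ab.
  have [[p _ pa] [q _ qb]] := (set_mem aA, set_mem bA).
  have /sep[G Gc Gpq] : p <> q.
    by move=> pq; apply: ab; apply: val_inj; rewrite /= -pa -qb pq.
  exists (G \o val); last by rewrite /= -pa -qb.
  move=> x; apply: continuous_comp; last exact: Gc.
  exact: initial_continuous.
- exact: (@continuous_comp_initial _ K T).
- move=> p q [pq]; apply: contrapT => /sep[G _]; apply.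
  by rewrite pq.
- by move=> [a aA]; have [p _ pa] := set_mem aA; exists p; exact: val_inj.
Qed.

End CompactHomeomorphisms.

(** * Recovering the function from the measure *)

Section Separation.
Variables (R : realType) (alpha : R).
Hypothesis alpha_irr : irrational alpha.
Local Notation m := (@circle_measure R).

Lemma locally_constant_at_int (f : R -> bool) (k : int) x : periodic1 f ->
  locally_constant_at f x -> locally_constant_at f (x + k%:~R).
Proof.
move=> fper [e e0 he]; exists e => // y yx.
rewrite periodic1_int// -[y](subrK k%:~R) periodic1_int// he//.
by rewrite -addrA -opprD [k%:~R + x]addrC.
Qed.

(* By density the orbit enters every right neighbourhood on which both functions
   are constant. *)
Lemma coding_translate (f f' : R -> bool) x x' : admissible f -> admissible f' ->
  (forall i : int, locally_constant_at f (x + i%:~R * alpha) ->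
     locally_constant_at f' (x' + i%:~R * alpha) ->
     f (x + i%:~R * alpha) = f' (x' + i%:~R * alpha)) ->
  forall u, f (x + u) = f' (x' + u).
Proof.
move=> [fper frlc] [fper' frlc'] hi u.
have [e1 e10 he1] := frlc (x + u); have [e2 e20 he2] := frlc' (x' + u).
pose e := Num.min e1 e2; have e0 : 0 < e by rewrite lt_min e10.
have d0 : 0 < e / 2 by rewrite divr_gt0.
have [K /(_ (u + e / 2))[k [n [_ hk]]]] := orbit_dense alpha_irr d0.
pose z := k%:R * alpha - n%:~R.
have /andP[z1 z2] : u < z < u + e.
  by move: hk; rewrite ltr_norml /z => /andP[h1 h2]; apply/andP; split; lra.
have [ze1 ze2] : z < u + e1 /\ z < u + e2.
  by apply/andP; rewrite -lt_min -[X in _ < X](_ : u + e = _) // /e addr_minr.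
have kz w : w + k%:Z%:~R * alpha = w + z + n%:~R by rewrite /z -pmulrn; ring.
rewrite -(he1 (x + z)); last by apply/andP; split; lra.
rewrite -(he2 (x' + z)); last by apply/andP; split; lra.
rewrite -(periodic1_int n (x + z) fper) -(periodic1_int n (x' + z) fper') -!kz.
apply: hi; rewrite kz; apply: locally_constant_at_int => //.
  by apply: (locally_constant_inside he1); apply/andP; split; lra.
by apply: (locally_constant_inside he2); apply/andP; split; lra.
Qed.

Lemma circle_measure_gt0 V : right_open V -> periodic1 V -> V !=set0 ->
  (0 < m V)%E.
Proof.
move=> oV pV [x0 Vx0].
have Vx : V (fpart x0) by rewrite /fpart -intrN periodic1_int.
have [e e0 he] := oV _ Vx; have /andP[x1 x2] := fpart_itv x0.
set x := fpart x0 in Vx he x1 x2.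
apply: (@lt_le_trans _ _ (@lebesgue_measure R `[x, Num.min (x + e) 1[%classic)).
  rewrite lebesgue_measure_itv/= lte_fin lt_min x2 ltrDl e0/= -EFinB lte_fin.
  by rewrite subr_gt0 lt_min x2 ltrDl e0.
apply: le_measure.
- by rewrite inE.
- rewrite inE; apply: measurableI; last exact: unit_interval_measurable.
  exact: right_open_measurable.
- move=> y; rewrite /= in_itv/= lt_min => /andP[xy /andP[ye y1]]; split.
    by apply: he; rewrite xy.
  by rewrite /unit_interval/= in_itv/= y1 (le_trans x1).
Qed.

Lemma window_indicator_continuous n (V : set Sigma2) : window_set n V ->
  continuous (fun s : Sigma2 => \1_V s : R).
Proof.
move=> wV s U sU; rewrite /nbhs/=; apply: filterS (nbhs_agree s n) => t st.
rewrite /= (_ : \1_V t = \1_V s :> R); first exact: nbhs_singleton.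
rewrite !indicE (_ : (t \in V) = (s \in V))//; apply/idP/idP; rewrite !inE; apply: wV => //.
exact: agreeC.
Qed.

(** Each cylinder around [itinerary alpha f 0] has positive measure for [f], hence for [f'], so this
    itinerary lies in the coding of [f']. Its base point there is the translation [rho]. *)
Lemma equal_integrals_translate (f f' : R -> bool)
    (fA : admissible f) (fA' : admissible f') :
  (forall F : Sigma2 -> R, continuous F ->
    \int[extended_measure (coding_point alpha_irr fA)]_x F x =
    \int[extended_measure (coding_point alpha_irr fA')]_x F x) ->
  exists rho, forall u, f u = f' (u + rho).
Proof.
move=> eqI.
have c0 : coding alpha f' (itinerary alpha f 0).
  apply/codingP => n; set s := itinerary alpha f 0.
  pose V := [set t | agree n s t].
  have wV : window_set n V.
    by move=> t t' tt' st; exact: agree_trans st tt'.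
  have Vc : continuous (\1_V : Sigma2 -> R) := @window_indicator_continuous n V wV.
  have := eqI _ Vc; rewrite (coding_integral alpha_irr fA Vc).
  rewrite (coding_integral alpha_irr fA' Vc).
  have Vopen g : admissible g -> right_open (itinerary_preimage alpha g V).
    by move=> [_ grlc]; exact/itinerary_preimage_open/(window_set_open wV).
  have intE g : admissible g -> \int[m]_x \1_V (itinerary alpha g x) =
      fine (m (itinerary_preimage alpha g V)).
    move=> gA; rewrite /Rintegral; congr fine.
    rewrite -[X in m X]setIT -integral_indic//.
    by apply: right_open_measurable; exact: Vopen.
  rewrite !intE// => e; apply: contrapT => no.
  have : (0 < m (itinerary_preimage alpha f V))%E.
    apply: circle_measure_gt0; [exact: Vopen|exact: (itinerary_preimage_periodic alpha fA.1 V)|].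
    by exists 0.
  rewrite -[m _]fineK; last first.
    by apply: fin_num_measure; apply: right_open_measurable; exact: Vopen.
  rewrite e (_ : itinerary_preimage alpha f' V = set0) ?measure0 ?ltxx//.
  by apply/seteqP; split=> // x Vx; apply: no; exists x.
have [rho hrho] := coding_base fA'.1 c0; exists rho => u.
rewrite -[u in LHS]add0r [u + rho]addrC.
by apply: coding_translate => // i _ /hrho.
Qed.

End Separation.

Lemma compact_set_type (T : topologicalType) (A : set T) :
  compact A -> compact [set: set_type A].
Proof.
move=> cA F FF _.
have FA : (val @ F) A.
  by apply: (@filterS _ F _ setT) => [x _|]; [exact: set_valP|exact: filterT].
have [p [Ap cl]] := cA _ _ FA.
exists (exist _ p (mem_set Ap)); split => // U V FU [_ [[W oW <-] /= Wp WV]].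
have FvU : (val @ F) (val @` U).
  by apply: (@filterS _ F _ U _ _ FU) => x Ux; exists x.
have [_ [[x Ux <-] Wx]] := cl _ _ FvU (open_nbhs_nbhs (conj oW Wp)).
by exists x; split => //; exact: WV.
Qed.

(** * Embedding compact spaces of parameters *)

Section BarEmbedding.
Variables (R : realType) (act : pred nat) (alpha : R).
Hypothesis alpha_irr : irrational alpha.

Lemma integral_continuous (F : Sigma2 -> R) : continuous F ->
  continuous (fun Y : ergodic_sets R shift_map => \int[extended_measure Y]_x F x).
Proof.
move=> Fc; pose Fb : continuousType Sigma2 R :=
  HB.pack F (isContinuous.Build _ _ F Fc).
move=> Y; have cI : continuous (@integrals R Sigma2 shift_map :
    invariant_measures R shift_map -> {ptws continuousType Sigma2 R -> R}).
  exact: initial_continuous.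
have cM : continuous (@ergodic_measure R Sigma2 shift_map :
    ergodic_sets R shift_map -> invariant_measures R shift_map).
  exact: initial_continuous.
have cIM := continuous_comp (cM Y) (cI _).
have cE : continuous (fun g : {ptws continuousType Sigma2 R -> R} => g Fb).
  exact: (@proj_continuous {classic continuousType Sigma2 R} (fun=> R) Fb).
exact: continuous_comp cIM (cE _).
Qed.

Variables (T : topologicalType) (p : T -> nat -> R).
Hypothesis p01 : forall x j, 0 <= p x j <= 1.
Hypothesis p_cont : forall j, continuous (fun x => p x j).
Hypothesis p_sep : forall x y : T, x <> y -> exists2 j, act j & p x j <> p y j.

Lemma bar_point_separated (x y : T) : x <> y ->
  exists2 F : Sigma2 -> R, continuous F &
    \int[extended_measure (bar_point act alpha_irr p01 x)]_s F s <>
    \int[extended_measure (bar_point act alpha_irr p01 y)]_s F s.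
Proof.
move=> xy; apply: contrapT => no.
have [F Fc|rho hrho] := @equal_integrals_translate _ _ alpha_irr _ _
    (bar_symbol_admissible act (p01 x)) (bar_symbol_admissible act (p01 y)).
  by apply: contrapT => ne; apply: no; exists F.
have [_ eqp] := bar_symbol_rigid (p01 x) (p01 y) hrho.
by have [j aj] := p_sep xy; apply; exact: eqp.
Qed.

Lemma ergodic_sets_copy : compact [set: T] ->
  contains_copy (ergodic_sets R shift_map) T.
Proof.
move=> cT; apply: (@compact_embedding R _ _ (bar_point act alpha_irr p01)) => //.
  exact: bar_point_continuous.
move=> x y /bar_point_separated[F Fc ne].
by exists (fun Y : ergodic_sets R shift_map => \int[extended_measure Y]_s F s);
  [exact: integral_continuous|].
Qed.

Lemma subset_copy (D : set (ergodic_sets R shift_map)) : compact [set: T] ->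
  (forall x, D (bar_point act alpha_irr p01 x)) -> contains_copy (set_type D) T.
Proof.
move=> cT hD.
pose phi x : set_type D := exist _ (bar_point act alpha_irr p01 x) (mem_set (hD x)).
apply: (@compact_embedding R _ _ phi) => //.
  apply: (@continuous_comp_initial _ T); exact: bar_point_continuous.
move=> x y /bar_point_separated[F Fc ne].
exists (fun Y : set_type D => \int[extended_measure (val Y)]_s F s) => //.
have ci : continuous (set_val : set_type D -> ergodic_sets R shift_map).
  exact: initial_continuous.
move=> Y; exact: (continuous_comp (ci Y) (@integral_continuous F Fc _)).
Qed.

End BarEmbedding.

Lemma hilbert_cube_compact (R : realType) : compact [set: hilbert_cube R].
Proof.
have c01 : compact [set: set_type (`[0, 1]%classic : set R)].
  exact/compact_set_type/segment_compact.
have := @tychonoff nat (fun=> set_type (`[0, 1]%classic : set R)) (fun=> setT)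
  (fun=> c01).
by congr compact; apply/seteqP; split.
Qed.

Lemma hilbert_cube_copy (R : realType) :
  contains_copy (ergodic_sets R shift_map) (hilbert_cube R).
Proof.
pose p (x : hilbert_cube R) j : R := val (x j).
(* All bars are active, one per coordinate of the cube; [pi] serves as the irrational angle. *)
apply: (@ergodic_sets_copy R predT pi pi_irrationnal _ p).
- by move=> x j; have := set_valP (x j); rewrite /= in_itv/=.
- move=> j x; apply: (@continuous_comp _ _ _ (fun x : hilbert_cube R => x j) val).
    exact: (@proj_continuous nat (fun=> set_type (`[0, 1]%classic : set R)) j).
  exact: initial_continuous.
- move=> x y xy; apply: contrapT => no; apply: xy; apply/funext => j.
  by apply: val_inj; apply: contrapT => ne; apply: no; exists j.
- exact: hilbert_cube_compact.
Qed.

(** * Denjoy examples *)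

Section Circle.
Variable R : realType.
Local Notation circle := (circle R).
Local Notation cover := (@circle_cover R).
Implicit Types (s t : R) (z : circle).

Lemma circle_cover_continuous : continuous cover.
Proof.
have c2 : continuous (fun t => 2 * pi * t : R).
  exact: mulrl_continuous.
have cc : continuous (fun t : R => cos (2 * pi * t)).
  by move=> t; apply: (@continuous_comp R R R _ cos); [exact: c2|exact: continuous_cos].
have cs : continuous (fun t : R => sin (2 * pi * t)).
  by move=> t; apply: (@continuous_comp R R R _ sin); [exact: c2|exact: continuous_sin].
apply: (@continuous_comp_initial circle R (R * R)%type set_val cover) => t.
exact: (cvg_pair (cc t) (cs t)).
Qed.

Lemma circle_hausdorff : hausdorff_space circle.
Proof.
have vc : continuous (set_val : circle -> R * R) by exact: initial_continuous.
apply: (@separated_hausdorff R) => z w zw.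
have [e1|n1] := pselect ((val z).1 = (val w).1); last first.
  exists (fun z : circle => (val z).1) => // x.
  apply: (@continuous_comp circle (R * R)%type R set_val fst); [exact: vc|exact: cvg_fst].
have [e2|n2] := pselect ((val z).2 = (val w).2); last first.
  exists (fun z : circle => (val z).2) => // x.
  apply: (@continuous_comp circle (R * R)%type R set_val snd); [exact: vc|exact: cvg_snd].
exfalso; apply: zw; apply: val_inj.
by rewrite [LHS]surjective_pairing [RHS]surjective_pairing e1 e2.
Qed.

Lemma circle_cover_surj z : exists t, cover t = z.
Proof.
case: z => -[x y] xyP; have /= xy1 := set_mem xyP.
have x2 : x ^+ 2 <= 1 by rewrite -xy1 lerDl sqr_ge0.
have x1 : -1 <= x <= 1.
  by rewrite -ler_norml -(ler_pXn2r (n := 2))// ?nnegrE// real_normK ?num_real// expr1n.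
have pi0 : (pi : R) != 0 by rewrite gt_eqF// pi_gt0.
have sa : sin (acos x) = `|y|.
  by rewrite sin_acos// -xy1 addrAC subrr add0r sqrtr_sqr.
have ca : cos (acos x) = x by rewrite acosK// in_itv.
have [y0|y0] := leP 0 y.
  exists (acos x / (2 * pi)); apply: val_inj => /=.
  have -> : 2 * pi * (acos x / (2 * pi)) = acos x by rewrite mulrC divfK// mulf_neq0.
  by rewrite ca sa ger0_norm.
exists (- acos x / (2 * pi)); apply: val_inj => /=.
have -> : 2 * pi * (- acos x / (2 * pi)) = - acos x by rewrite mulrC divfK// mulf_neq0.
by rewrite cosN sinN ca sa ltr0_norm// opprK.
Qed.

Lemma circle_cover_periodic : periodic1 cover.
Proof.
move=> t; apply: val_inj => /=.
have -> : 2 * pi * (t + 1) = 2 * pi * t + pi *+ 2 :> R by rewrite -mulr_natl; ring.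
by rewrite cosD2pi sinD2pi.
Qed.

(** With [r] the fractional part of [s - t], the double angle formula turns [cos (2 pi r) = 1] into
    [sin (pi r) = 0], while [sin] is positive strictly between 0 and [pi]. *)
Lemma circle_coverP s t : cover s = cover t -> exists m : int, s = t + m%:~R.
Proof.
move=> [ec es]; exists (Num.floor (s - t)).
suff r0 : fpart (s - t) = 0 by move: r0; rewrite /fpart; lra.
have cos1 : cos (2 * pi * fpart (s - t)) = 1.
  have -> : cos (2 * pi * fpart (s - t)) = cos (2 * pi * (s - t)).
    have cper : periodic1 (fun x : R => cos (2 * pi * x)).
      by move=> x; have /(congr1 val)[] := circle_cover_periodic x.
    by rewrite /fpart -intrN (periodic1_int _ _ cper).
  by rewrite mulrBr cosB ec es -!expr2 cos2Dsin2.
apply/eqP; rewrite eq_le fpart_ge0 andbT leNgt; apply/negP => r0.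
have : 0 < sin (pi * fpart (s - t)).
  apply: sin_gt0_pi; rewrite mulr_gt0 ?pi_gt0//=.
  by rewrite gtr_pMr ?pi_gt0// fpart_lt1.
move: cos1; have -> : 2 * pi * fpart (s - t) = (pi * fpart (s - t)) *+ 2.
  by rewrite -mulr_natl; ring.
rewrite cos_mulr2n cos2sin2 => c1.
have /eqP : sin (pi * fpart (s - t)) ^+ 2 = 0 by rewrite mulr2n in c1; lra.
by rewrite sqrf_eq0 => /eqP ->; rewrite ltxx.
Qed.

Definition circle_arg z : R := projT1 (cid (circle_cover_surj z)).

Lemma circle_argK z : cover (circle_arg z) = z.
Proof. exact: projT2 (cid (circle_cover_surj z)). Qed.

Lemma circle_cover_compact_image (A : set R) : closed A ->
  compact (cover @` (A `&` `[0, 1]%classic)).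
Proof.
move=> cA; apply: continuous_compact.
  exact/continuous_subspaceT/circle_cover_continuous.
by rewrite setIC; apply: compact_closedI => //; exact: segment_compact.
Qed.

Lemma circle_cover_image_itv (A : set R) : periodic1 A ->
  cover @` (A `&` `[0, 1]%classic) = cover @` A.
Proof.
move=> pA; apply/seteqP; split=> [_ [t [At _] <-]|_ [t At <-]]; first by exists t.
exists (fpart t); last first.
  by rewrite /fpart -intrN (periodic1_int _ _ circle_cover_periodic).
split; first by rewrite /fpart -intrN periodic1_int.
by rewrite /= in_itv/= fpart_ge0 ltW// fpart_lt1.
Qed.

Section CircleMap.
Variable F : R -> R.
Hypothesis F_degree1 : forall t, F (t + 1) = F t + 1.

Definition circle_map z := cover (F (circle_arg z)).

Lemma degree1_int t (m : int) : F (t + m%:~R) = F t + m%:~R.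
Proof.
have h : periodic1 (fun x => F x - x) by move=> x; rewrite F_degree1; ring.
by have := periodic1_int m t h; lra.
Qed.

Lemma circle_mapE t : circle_map (cover t) = cover (F t).
Proof.
rewrite /circle_map; have [m ->] := circle_coverP (circle_argK (cover t)).
by rewrite degree1_int periodic1_int//; exact: circle_cover_periodic.
Qed.

(** [circle_arg] is an arbitrary section, not a continuous one. Closed sets are instead pulled back
    to closed periodic sets of the line, and recovered as images of compact subsets of [0, 1]. *)
Lemma circle_map_continuous : continuous F -> continuous circle_map.
Proof.
move=> Fc; apply/continuous_closedP => C cC.
pose A := (cover \o F) @^-1` C.
have cF : continuous (cover \o F).
  by move=> t; apply: continuous_comp; [exact: Fc|exact: circle_cover_continuous].
have cA : closed A by move/continuous_closedP : cF; exact.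
have pA : periodic1 A.
  by move=> t; rewrite /A/= F_degree1 circle_cover_periodic.
have -> : circle_map @^-1` C = cover @` (A `&` `[0, 1]%classic).
  rewrite circle_cover_image_itv//; apply/seteqP; split=> [z Cz|_ [t At <-]].
    by exists (circle_arg z); rewrite ?circle_argK.
  by rewrite /= circle_mapE.
by apply: compact_closed; [exact: circle_hausdorff|exact: circle_cover_compact_image].
Qed.

End CircleMap.
End Circle.

(** * An increasing function with prescribed jumps *)

Section WeightedSums.
Variable R : realType.
Implicit Types (u v : nat -> R) (C : R) (n k N : nat).
Local Notation gap := (gap R).

Definition weighted_sum u : R := limn (series (fun k => gap k * u k)).

Lemma weighted_sum_cvg C u : (forall k, `|u k| <= C) ->
  cvgn (series (fun k => gap k * u k)).
Proof.
move=> hu; have C0 : 0 <= C by exact: le_trans (hu 0%N).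
apply: normed_cvg.
apply: (@series_le_cvg _ _ (geometric (C / 2) 2^-1)) => [k|k|k|].
- by rewrite normr_ge0.
- by rewrite /geometric/= mulr_ge0 ?divr_ge0// exprn_ge0// invr_ge0.
- rewrite /= normrM ger0_norm ?(ltW (gap_gt0 _ _))// /geometric/= /gap exprS.
  have p0 : 0 <= 2^-1 ^+ k :> R by rewrite exprn_ge0// invr_ge0.
  by have := ler_wpM2l p0 (hu k); lra.
apply: is_cvg_geometric_series.
by rewrite gtr0_norm ?invr_gt0// invf_lt1// ltr1n.
Qed.

Lemma weighted_sumB C u v :
  (forall k, `|u k| <= C) -> (forall k, `|v k| <= C) ->
  weighted_sum (fun k => u k - v k) = weighted_sum u - weighted_sum v.
Proof.
move=> hu hv; rewrite /weighted_sum -lim_seriesB; try exact: weighted_sum_cvg.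
by congr (limn (series _)); apply/funext => k; rewrite mulrBr.
Qed.

Lemma weighted_sum_ge C u k : (forall k, 0 <= u k <= C) ->
  gap k * u k <= weighted_sum u.
Proof.
move=> hu; have nd : {homo series (fun k => gap k * u k) : n m / (n <= m)%N >-> n <= m}.
  apply/nondecreasing_seqP => n; rewrite seriesSr lerDl mulr_ge0 ?(ltW (gap_gt0 _ _))//.
  by case/andP: (hu n).
apply: (@le_trans _ _ (series (fun k => gap k * u k) k.+1)).
  rewrite seriesSr lerDr; elim: k => [|k IH]; first by rewrite /series/= big_geq.
  rewrite seriesSr addr_ge0// mulr_ge0 ?(ltW (gap_gt0 _ _))//.
  by case/andP: (hu k).
apply: nondecreasing_cvgn_le => //; apply: (@weighted_sum_cvg C) => j.
by have /andP[u0 uC] := hu j; rewrite ger0_norm.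
Qed.

Lemma weighted_sum_ge0 C u : (forall k, 0 <= u k <= C) -> 0 <= weighted_sum u.
Proof.
move=> hu; apply: le_trans (weighted_sum_ge 0 hu).
by rewrite mulr_ge0 ?(ltW (gap_gt0 _ _))//; case/andP: (hu 0%N).
Qed.

Lemma weighted_sum_tail C u N : (forall k, 0 <= u k <= C) ->
  (forall k, (k < N)%N -> u k = 0) -> weighted_sum u <= 2 * C * gap N.
Proof.
move=> hu u0; have C0 : 0 <= C by case/andP: (hu 0%N); apply: le_trans.
apply: limr_le.
  apply: (@weighted_sum_cvg C) => j.
  by have /andP[uj0 uC] := hu j; rewrite ger0_norm.
apply: nearW => n.
(* The induction carries the remaining tail, using [C * gap n = 2 * C * gap n - 2 * C * gap
   n.+1]. *)
suff : series (fun k => gap k * u k) n + 2 * C * gap (maxn n N) <= 2 * C * gap N.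
  by apply: le_trans; rewrite lerDl !mulr_ge0// ltW// gap_gt0.
elim: n => [|n IH]; first by rewrite /series/= big_geq// add0r max0n.
rewrite seriesSr; have [nN|Nn] := ltnP n N.
  by rewrite u0// mulr0 addr0 (maxn_idPr nN); move: IH; rewrite (maxn_idPr (ltnW nN)).
move: IH; rewrite (maxn_idPl Nn) (maxn_idPl (leqW Nn)); apply: le_trans.
rewrite -addrA lerD2l; have := gapS R n; have gn := gap_gt0 R n.
have /andP[_ uC] := hu n; have : gap n * u n <= gap n * C by rewrite ler_pM2l.
by move=> h1 h2; rewrite h2 in h1; rewrite h2; lra.
Qed.

End WeightedSums.

Section JumpFunction.
Variable R : realType.
Variable d : nat -> R.
Hypothesis d01 : forall k, 0 <= d k < 1.
Implicit Types (x y : R).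
Local Notation gap := (gap R).

Definition jump_set : set R := [set x | exists k (m : int), x = d k + m%:~R].

Let fl x k : R := (Num.floor (x - d k))%:~R.

Let fl_itv x k : x - d k - 1 < fl x k <= x - d k.
Proof.
have /andP[h1 h2] := floor_itv (x - d k); rewrite /fl h1 andbT.
by rewrite intrD in h2; lra.
Qed.

Let fl_bound x k : `|fl x k| <= `|x| + 2.
Proof.
have /andP[h1 h2] := fl_itv x k; have /andP[h3 h4] := d01 k.
have := ler_norm x; have := ler_norm (- x); rewrite normrN ler_norml => h5 h6.
by apply/andP; split; lra.
Qed.

Let fl_le x y k : x <= y -> fl x k <= fl y k.
Proof. by move=> xy; rewrite ler_int; apply: le_floor; rewrite lerD2r. Qed.

Let S x : R := weighted_sum (fl x).

Let SB x y : S y - S x = weighted_sum (fun k => fl y k - fl x k).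
Proof.
rewrite /S (@weighted_sumB _ (`|x| + `|y| + 2))// => k.
  by apply: le_trans (fl_bound y k) _; have := normr_ge0 x; lra.
by apply: le_trans (fl_bound x k) _; have := normr_ge0 y; lra.
Qed.

Let diff_itv x y k : x <= y -> 0 <= fl y k - fl x k <= y - x + 1.
Proof.
move=> xy; have := fl_le k xy; have /andP[h1 h2] := fl_itv x k.
by have /andP[h3 h4] := fl_itv y k; move=> h5; apply/andP; split; lra.
Qed.

Let S_le x y : x <= y -> S x <= S y.
Proof.
move=> xy; rewrite -subr_ge0 SB.
by apply: (@weighted_sum_ge0 _ (y - x + 1)) => k; exact: diff_itv.
Qed.

Let W : R := weighted_sum (fun=> 1 : R).

Let W_ge0 : 0 <= W.
Proof. by apply: (@weighted_sum_ge0 _ 1) => k; rewrite ler01 lexx. Qed.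

Let SD1 x : S (x + 1) = S x + W.
Proof.
suff e : (fun k => fl (x + 1) k - fl x k) = (fun=> 1).
  by have := SB x (x + 1); rewrite e -/W; lra.
apply/funext => k; rewrite /fl.
have -> : Num.floor (x + 1 - d k) = Num.floor (x - d k) + 1.
  apply: floor_def; have /andP[h1 h2] := floor_itv (x - d k).
  by rewrite !intrD in h2 *; apply/andP; split; lra.
by rewrite intrD; ring.
Qed.

(** The weighted sum of the floors of [x - d k] jumps by [gap k] at [d k] modulo 1; repetitions in
    [d] only enlarge a jump. The summand [x] makes the function strictly increasing, and [1 + W],
    the increment over a period, normalizes it to degree one. *)
Definition jump_function x : R := (x + S x) / (1 + W).

Let W1 : 0 < 1 + W. Proof. by rewrite ltr_pwDl. Qed.

Lemma jump_function_homo x y : x < y -> jump_function x < jump_function y.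
Proof.
by move=> xy; rewrite ltr_pM2r ?invr_gt0// ltr_leD// S_le// ltW.
Qed.

Lemma jump_functionD1 x : jump_function (x + 1) = jump_function x + 1.
Proof.
rewrite /jump_function SD1 (_ : x + 1 + (S x + W) = x + S x + (1 + W)); last by ring.
by rewrite mulrDl divff// gt_eqF.
Qed.

Lemma jump_function_jump z : jump_set z -> exists2 g, 0 < g &
  forall x y, x < z < y -> jump_function x + g <= jump_function y.
Proof.
move=> [k [m zE]]; exists (gap k / (1 + W)); first by rewrite divr_gt0// gap_gt0.
move=> x y /andP[xz zy]; rewrite -mulrDl ler_pM2r ?invr_gt0//.
have xy : x < y by exact: lt_trans zy.
suff : gap k <= S y - S x by lra.
rewrite SB.
apply: le_trans (@weighted_sum_ge _ (y - x + 1) _ k _); last first.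
  by move=> j; exact/diff_itv/ltW.
apply: ler_peMr; first by rewrite ltW// gap_gt0.
have : Num.floor (x - d k) + 1 <= Num.floor (y - d k).
  rewrite floor_ge_int; apply: (@le_trans _ _ m%:~R); last by lra.
  rewrite ler_int lezD1 -(ltr_int R).
  by apply: le_lt_trans (floor_le _) _; lra.
by rewrite -(ler_int R) intrD /fl /= => h; lra.
Qed.

(** Near [z] the first [N] floors are constant, and the others contribute a geometric tail. *)
Lemma jump_function_cont z e : ~ jump_set z -> 0 < e ->
  exists x y, x < z < y /\ jump_function y - jump_function x < e.
Proof.
move=> nz e0; pose e1 := e * (1 + W) / 2.
have e10 : 0 < e1 by rewrite divr_gt0// mulr_gt0.
have [N hN] := @gap_small R (e1 / 4) (ltac:(by rewrite divr_gt0)).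
have [r r0 hr] : exists2 r, 0 < r & forall k x y, (k < N)%N ->
    z - r < x -> x < z -> z < y -> y < z + r -> fl y k = fl x k.
  elim: N {hN} => [|N [r r0 hr]]; first by exists 1.
  have /andP[h1 h2] := floor_itv (z - d N).
  set m := Num.floor (z - d N) in h1 h2; rewrite intrD in h2.
  have h1' : m%:~R < z - d N.
    rewrite lt_neqAle h1 andbT; apply/eqP => mE; apply: nz; exists N, m.
    by rewrite mE; ring.
  exists (Num.min r (Num.min (z - d N - m%:~R) (m%:~R + 1 - (z - d N)))).
    by rewrite !lt_min r0 !subr_gt0 h1' h2.
  move=> k x y; rewrite ltrBlDr -ltrBlDl !lt_min => kN /andP[x1 /andP[x2 x3]].
  move=> xz zy; rewrite -ltrBlDl !lt_min => /andP[y1 /andP[y2 y3]].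
  move: kN; rewrite ltnS leq_eqVlt => /orP[/eqP ->|kN]; last first.
    by apply: hr => //; lra.
  by rewrite /fl !(@floor_def _ _ m)// intrD; apply/andP; split; lra.
(* The bound 1/2 keeps each difference of floors at most 2, the constant of the tail estimate. In
   all, the numerator grows by less than [2 * e1 = e * (1 + W)]. *)
pose q := Num.min (r / 2) (Num.min (1 / 2) (e1 / 4)).
have q0 : 0 < q by rewrite !lt_min; apply/and3P; split; lra.
have [qr [q1 qe]] : q <= r / 2 /\ q <= 1 / 2 /\ q <= e1 / 4.
  by split; [|split]; rewrite /q !ge_min lexx ?orbT.
exists (z - q), (z + q); split; first by apply/andP; split; lra.
rewrite /jump_function -mulrBl ltr_pdivrMr//.
have := SB (z - q) (z + q); have xy : z - q <= z + q by lra.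
have := @weighted_sum_tail R 2 (fun k => fl (z + q) k - fl (z - q) k) N _ _.
move=> tail SE.
have : S (z + q) - S (z - q) <= 2 * 2 * gap N.
  rewrite SE; apply: tail => k.
    by have /andP[h1 h2] := diff_itv k xy; apply/andP; split; lra.
  by move=> kN; rewrite (hr k (z - q) (z + q))// ?subrr//; lra.
by rewrite /e1 in e10 hN qe; lra.
Qed.

End JumpFunction.

(** * Blowing up points of the line *)

Section BlowUp.
Variable R : realType.
Implicit Types (x y z e : R).

(* [blow_up D L U]: the real line with every point x of D replaced by the
   interval [L x, U x]. *)
Definition blow_up (D : set R) (L U : R -> R) : Prop :=
  [/\ forall x, L x <= U x,
      forall x y, x < y -> U x < L y,
      forall x, L (x + 1) = L x + 1 /\ U (x + 1) = U x + 1,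
      forall x, D x <-> L x < U x &
      forall y, exists x, L x <= y <= U x].

Section FromJumps.
Variables (J : R -> R) (D : set R).
Hypothesis J_homo : forall x y, x < y -> J x < J y.
Hypothesis JD1 : forall x, J (x + 1) = J x + 1.
Hypothesis J_jump : forall z, D z -> exists2 g, 0 < g &
  forall x y, x < z < y -> J x + g <= J y.
Hypothesis J_cont : forall z e, ~ D z -> 0 < e ->
  exists x y, x < z < y /\ J y - J x < e.

Let lower x : set R := [set J y | y in [set y | y < x]].
Let upper x : set R := [set J y | y in [set y | x < y]].
Let L x : R := sup (lower x).
Let U x : R := inf (upper x).

Let lower_sup x : has_sup (lower x).
Proof.
split; first by exists (J (x - 1)), (x - 1) => //=; lra.
by exists (J x) => _ [y /= yx <-]; exact/ltW/J_homo.
Qed.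

Let upper_inf x : has_inf (upper x).
Proof.
split; first by exists (J (x + 1)), (x + 1) => //=; lra.
by exists (J x) => _ [y /= yx <-]; exact/ltW/J_homo.
Qed.

Let L_ge x y : y < x -> J y <= L x.
Proof. by move=> yx; apply: (ub_le_sup (lower_sup x).2); exists y. Qed.

Let U_le x y : x < y -> U x <= J y.
Proof. by move=> xy; apply: (ge_inf (upper_inf x).2); exists y. Qed.

Let L_le x c : (forall y, y < x -> J y <= c) -> L x <= c.
Proof. by move=> h; apply: (ge_sup (lower_sup x).1) => _ [y /= yx <-]; exact: h. Qed.

Let U_ge x c : (forall y, x < y -> c <= J y) -> c <= U x.
Proof. by move=> h; apply: (lb_le_inf (upper_inf x).1) => _ [y /= yx <-]; exact: h. Qed.

(* With L and U defined as one-sided limits of J, the intervals [L x, U x] cover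
   the line without any continuity argument. *)
Lemma blow_up_of_jumps : exists L U, blow_up D L U.
Proof.
exists L, U; split.
- by move=> x; apply: L_le => y yx; apply: U_ge => z xz; apply/ltW/J_homo; lra.
- move=> x y xy; have h1 : x < (2 * x + y) / 3 by lra.
  have h2 : (2 * x + y) / 3 < (x + 2 * y) / 3 by lra.
  have h3 : (x + 2 * y) / 3 < y by lra.
  by apply: (le_lt_trans (U_le h1)); apply: (lt_le_trans (J_homo h2)); exact: L_ge.
- have JB y : J y = J (y - 1) + 1 by rewrite -JD1 subrK.
  move=> x; split; apply/eqP; rewrite eq_le; apply/andP; split.
  + apply: L_le => y yx; rewrite JB lerD2r; apply: L_ge; lra.
  + by rewrite -lerBrDr; apply: L_le => y yx; rewrite lerBrDr -JD1; apply: L_ge; lra.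
  + by rewrite -lerBlDr; apply: U_ge => y yx; rewrite lerBlDr -JD1; apply: U_le; lra.
  + apply: U_ge => y yx; rewrite JB lerD2r; apply: U_le; lra.
- move=> x; split=> [Dx|LU].
    have [g g0 hg] := J_jump Dx; rewrite -subr_gt0; apply: (lt_le_trans g0).
    rewrite lerBrDr; apply: U_ge => z xz; rewrite addrC -lerBrDr.
    by apply: L_le => y yx; rewrite lerBrDr; apply: hg; rewrite yx.
  apply: contrapT => nD; have e0 : 0 < U x - L x by rewrite subr_gt0.
  have [a [b [/andP[ax xb] ab]]] := J_cont nD e0.
  by have := L_ge ax; have := U_le xb; lra.
(* The point whose interval contains [y] is the supremum of [A], which is nonempty and bounded above
   because [J] grows by 1 over each period. *)
- move=> y; pose A : set R := [set x | J x <= y].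
  have Jn (n : nat) x : J (x + n%:R) = J x + n%:R.
    by elim: n x => [|n IH] x; rewrite ?addr0// -natr1 !addrA JD1 IH.
  have JN (n : nat) x : J (x - n%:R) = J x - n%:R by rewrite -[in RHS](subrK n%:R x) Jn addrK.
  have J_le a b : a <= b -> J a <= J b.
    by rewrite le_eqVlt => /orP[/eqP ->//|/J_homo /ltW].
  have supA : has_sup A.
    split.
      exists (0 - (Num.trunc `|J 0 - y|).+1%:R); rewrite /A/= JN.
      have /andP[_] := truncn_itv (normr_ge0 (J 0 - y)).
      by have := ler_norm (J 0 - y); lra.
    exists (0 + (Num.trunc `|y - J 0|).+1%:R) => x Ax; rewrite leNgt; apply/negP => lx.
    have := J_homo lx; rewrite Jn; rewrite /A/= in Ax.
    have /andP[_] := truncn_itv (normr_ge0 (y - J 0)).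
    by have := ler_norm (y - J 0); lra.
  exists (sup A); apply/andP; split.
    apply: L_le => x xA; have [z Az xz] := sup_gt supA.1 xA.
    exact: le_trans (ltW (J_homo xz)) Az.
  apply: U_ge => x Ax; rewrite leNgt; apply/negP => xy.
  by have := ub_le_sup supA.2 (ltW xy : A x); rewrite leNgt Ax.
Qed.

End FromJumps.

Lemma blow_up_exists (d : nat -> R) : (forall k, 0 <= d k < 1) ->
  exists L U, blow_up (jump_set d) L U.
Proof.
move=> d01; apply: (@blow_up_of_jumps (jump_function d)).
- by move=> x y; exact: jump_function_homo.
- exact: jump_functionD1.
- exact: jump_function_jump.
- exact: jump_function_cont.
Qed.

Section DenjoyMap.
Variables (D : set R) (L U : R -> R).
Hypothesis LU_blow : blow_up D L U.

Let LU x : L x <= U x. Proof. by case: LU_blow. Qed.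
Let UL x y : x < y -> U x < L y. Proof. by case: LU_blow => _ h _ _ _; exact: h. Qed.
Let L1 x : L (x + 1) = L x + 1. Proof. by case: LU_blow => _ _ h _ _; case: (h x). Qed.
Let U1 x : U (x + 1) = U x + 1. Proof. by case: LU_blow => _ _ h _ _; case: (h x). Qed.
Let LUD x : D x <-> L x < U x. Proof. by case: LU_blow. Qed.

Let collapse_ex y : exists x, L x <= y <= U x. Proof. by case: LU_blow. Qed.

Definition collapse y : R := projT1 (cid (collapse_ex y)).

Lemma collapse_itv y : L (collapse y) <= y <= U (collapse y).
Proof. exact: projT2 (cid (collapse_ex y)). Qed.

Lemma collapse_unique x y : L x <= y <= U x -> collapse y = x.
Proof.
move=> /andP[h1 h2]; have /andP[h3 h4] := collapse_itv y.
by have [/UL|/UL|//] := ltgtP (collapse y) x; lra.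
Qed.

Lemma collapseL x : collapse (L x) = x.
Proof. by apply: collapse_unique; rewrite lexx LU. Qed.

Lemma collapseU x : collapse (U x) = x.
Proof. by apply: collapse_unique; rewrite lexx LU. Qed.

Lemma collapseD1 y : collapse (y + 1) = collapse y + 1.
Proof. by apply: collapse_unique; rewrite L1 U1 !lerD2r collapse_itv. Qed.

Lemma collapse_homo y z : y <= z -> collapse y <= collapse z.
Proof.
move=> yz; rewrite leNgt; apply/negP => /UL.
by have /andP[h1 h2] := collapse_itv y; have /andP[h3 h4] := collapse_itv z; lra.
Qed.

(* The relative position of y in the interval replacing [collapse y]; it is 0
   when this interval is a point, because division by 0 gives 0. *)
Definition position y : R :=
  (y - L (collapse y)) / (U (collapse y) - L (collapse y)).

(** Translation by [b] on the collapsed line, made affine on each inserted interval; for [b = alpha]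
    it lifts the Denjoy map. *)
Definition blown_rotation (b : R) y : R :=
  L (collapse y + b) + position y * (U (collapse y + b) - L (collapse y + b)).

Lemma position_itv y : 0 <= position y <= 1.
Proof.
have /andP[h1 h2] := collapse_itv y; rewrite /position.
have [e|ne] := eqVneq (U (collapse y) - L (collapse y)) 0.
  by rewrite e invr0 mulr0 lexx ler01.
have g0 : 0 < U (collapse y) - L (collapse y) by rewrite lt_neqAle eq_sym ne subr_ge0 LU.
by rewrite divr_ge0 ?subr_ge0//= ler_pdivrMr// mul1r lerD2r.
Qed.

Lemma blown_rotation_itv b y :
  L (collapse y + b) <= blown_rotation b y <= U (collapse y + b).
Proof.
have /andP[p0 p1] := position_itv y; have g := LU (collapse y + b).
rewrite /blown_rotation lerDl mulr_ge0 ?subr_ge0//= -lerBrDl.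
by rewrite ler_piMl// subr_ge0.
Qed.

Lemma collapse_blown_rotation b y : collapse (blown_rotation b y) = collapse y + b.
Proof. by apply: collapse_unique; exact: blown_rotation_itv. Qed.

Lemma blown_rotationD1 b y : blown_rotation b (y + 1) = blown_rotation b y + 1.
Proof.
rewrite /blown_rotation /position collapseD1 [collapse y + 1 + b]addrAC !L1 !U1.
have e (v w : R) : v + 1 - (w + 1) = v - w by ring.
by rewrite !e; ring.
Qed.

Section Invariant.
Variable b : R.
Hypothesis Db : forall x, D (x + b) <-> D x.

Lemma blown_rotationL x : blown_rotation b (L x) = L (x + b).
Proof. by rewrite /blown_rotation /position collapseL subrr mul0r mul0r addr0. Qed.

Let no_gap x : ~ D x -> U x = L x.
Proof.
by move=> nD; apply/eqP; rewrite eq_le LU andbT leNgt; apply/negP => /LUD.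
Qed.

Lemma blown_rotationU x : blown_rotation b (U x) = U (x + b).
Proof.
rewrite /blown_rotation /position collapseU.
have [Dx|nD] := pselect (D x).
  rewrite divff ?mul1r; first by ring.
  by rewrite gt_eqF// subr_gt0; exact/LUD.
have nDb : ~ D (x + b) by move/Db.
by rewrite (no_gap nD) (no_gap nDb) !subrr mulr0 addr0.
Qed.

Lemma blown_rotation_homo y z : y < z -> blown_rotation b y < blown_rotation b z.
Proof.
move=> yz; have := collapse_homo (ltW yz).
rewrite le_eqVlt => /orP[/eqP e|lt]; last first.
  have /andP[_ h1] := blown_rotation_itv b y.
  have /andP[h2 _] := blown_rotation_itv b z.
  apply: (le_lt_trans h1); apply: lt_le_trans h2.
  by apply: UL; rewrite ltrD2r.
have /andP[h1 h2] := collapse_itv y; have /andP[h3 h4] := collapse_itv z.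
have Dy : D (collapse y) by apply/LUD; rewrite -e in h4; lra.
have g1 : 0 < U (collapse y + b) - L (collapse y + b).
  by rewrite subr_gt0; apply/LUD/Db.
have g0 : 0 < U (collapse y) - L (collapse y) by rewrite subr_gt0; exact/LUD.
rewrite /blown_rotation -e ltrD2l ltr_pM2r// /position -e ltr_pM2r ?invr_gt0//.
by rewrite ltrD2r.
Qed.

Lemma blown_rotationK : cancel (blown_rotation b) (blown_rotation (- b)).
Proof.
move=> y; rewrite {1}/blown_rotation collapse_blown_rotation addrK /position.
rewrite collapse_blown_rotation /blown_rotation addrAC subrr add0r.
have [Dx|nD] := pselect (D (collapse y)).
  have g1 : U (collapse y + b) - L (collapse y + b) != 0.
    by rewrite gt_eqF// subr_gt0; apply/LUD/Db.
  have g0 : U (collapse y) - L (collapse y) != 0.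
    by rewrite gt_eqF// subr_gt0; apply/LUD.
  by rewrite mulfK// /position divfK//; ring.
have := no_gap nD; have /andP[h1 h2] := collapse_itv y => e.
rewrite e subrr mulr0 addr0; lra.
Qed.

End Invariant.

(** A strictly increasing bijection of the line is continuous; the inverse is the blown-up rotation
    by [- b]. *)
Lemma blown_rotation_continuous b : (forall x, D (x + b) <-> D x) ->
  continuous (blown_rotation b).
Proof.
move=> Db; have DN x : D (x + - b) <-> D x by rewrite -[in X in _ <-> X](subrK b x) Db.
move=> y; apply/cvgrPdist_lt => e e0.
pose G := blown_rotation (- b).
have GK : cancel G (blown_rotation b).
  by move=> z; have := blown_rotationK DN z; rewrite opprK.
have KG : cancel (blown_rotation b) G by exact: blown_rotationK.
set v := blown_rotation b y.
have h1 : G (v - e) < y by rewrite -[ltRHS]KG; apply: (blown_rotation_homo DN); rewrite -/v; lra.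
have h2 : y < G (v + e) by rewrite -[ltLHS]KG; apply: (blown_rotation_homo DN); rewrite -/v; lra.
have yI : y \in `](G (v - e)), (G (v + e))[ by rewrite in_itv/= h1.
apply: filterS (near_in_itvoo yI) => z; rewrite in_itv/= => /andP[z1 z2].
have := blown_rotation_homo Db z1; have := blown_rotation_homo Db z2.
by rewrite !GK => h3 h4; rewrite distrC ltr_norml; apply/andP; split; lra.
Qed.

End DenjoyMap.
End BlowUp.

(** * The Denjoy example and its Cantor set *)

Section DenjoyExample.
Variables (R : realType) (D : set R) (L U : R -> R).
Hypothesis LU_blow : blow_up D L U.
Variable alpha : R.
Hypothesis alpha_irr : irrational alpha.
Hypothesis D_alpha : forall x, D (x + alpha) <-> D x.
Hypothesis D_neq0 : D !=set0.
Local Notation cover := (@circle_cover R).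
Local Notation F := (blown_rotation LU_blow alpha).
Local Notation G := (blown_rotation LU_blow (- alpha)).
Local Notation collapse := (collapse LU_blow).

Let D_Nalpha x : D (x - alpha) <-> D x.
Proof. by rewrite -[in X in _ <-> X](subrK alpha x) D_alpha. Qed.

Let FK : cancel F G. Proof. exact: blown_rotationK. Qed.

Let GK : cancel G F.
Proof. by move=> y; have := blown_rotationK LU_blow D_Nalpha y; rewrite opprK. Qed.

Definition denjoy_map : circle R -> circle R := circle_map F.

Lemma denjoy_mapE t : denjoy_map (cover t) = cover (F t).
Proof. by apply: circle_mapE => x; exact: blown_rotationD1. Qed.

Let denjoy_inv : circle R -> circle R := circle_map G.

Let denjoy_invE t : denjoy_inv (cover t) = cover (G t).
Proof. by apply: circle_mapE => x; exact: blown_rotationD1. Qed.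

Let denjoy_mapK : cancel denjoy_map denjoy_inv.
Proof.
by move=> z; rewrite -[z]circle_argK denjoy_mapE denjoy_invE FK.
Qed.

Let denjoy_invK : cancel denjoy_inv denjoy_map.
Proof.
by move=> z; rewrite -[z]circle_argK denjoy_invE denjoy_mapE GK.
Qed.

Lemma denjoy_map_homeomorphism : homeomorphism denjoy_map.
Proof.
exists denjoy_inv; split => //; apply: circle_map_continuous => [x|].
- exact: blown_rotationD1.
- exact: blown_rotation_continuous.
- exact: blown_rotationD1.
- exact: blown_rotation_continuous.
Qed.

Lemma denjoy_lift : increasing_lift denjoy_map F.
Proof.
split; first exact: blown_rotation_continuous.
  by move=> x y; exact: blown_rotation_homo.
exact: denjoy_mapE.
Qed.

Lemma collapse_bound : exists C, forall y, `|y - collapse y| <= C.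
Proof.
have [LU UL L1U1 _ _] := LU_blow.
have L1 x : L (x + 1) = L x + 1 by case: (L1U1 x).
have Lle x y : x <= y -> L x <= L y.
  by rewrite le_eqVlt => /orP[/eqP ->//|/UL/ltW]; apply: le_trans.
exists (`|L 0| + 2) => y; have /andP[h1 h2] := collapse_itv LU_blow y.
set x := collapse y in h1 h2 *.
have Ux : U x < L x + 1 by rewrite -L1; apply: UL; lra.
have Lx : L x = L (fpart x) + (Num.floor x)%:~R by rewrite -degree1_int// subrK.
have /andP[f0 f1] := fpart_itv x.
have h3 := Lle _ _ f0; have h4 := Lle _ _ (ltW f1); rewrite -[1]add0r L1 in h4.
have := ler_norm (L 0); have := ler_norm (- L 0); rewrite normrN => h5 h6.
by rewrite ler_norml; move: f0 f1; rewrite /fpart => f0 f1; apply/andP; split; lra.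
Qed.

(** [collapse] semiconjugates [F] to the translation by [alpha] and stays at bounded distance from
    the identity, so both maps have the same mean displacement. *)
Lemma denjoy_rotation_number : rotation_number denjoy_map alpha.
Proof.
exists F; first exact: denjoy_lift.
move=> t; have [C hC] := collapse_bound.
have C0 : 0 <= C by exact: le_trans (hC 0).
have iterC n : collapse (iter n F t) = collapse t + n%:R * alpha.
  elim: n => [|n IH]; first by rewrite mul0r addr0.
  by rewrite iterS collapse_blown_rotation IH -natr1; ring.
apply/cvgrPdist_lt => e e0.
exists (Num.trunc (2 * C / e)).+1 => // n /= Nn.
have n0 : 0 < n%:R :> R by rewrite ltr0n; exact: leq_ltn_trans Nn.
have ne : 2 * C < e * n%:R.
  have q0 : 0 <= 2 * C / e by rewrite divr_ge0 ?mulr_ge0// ltW.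
  rewrite -ltr_pdivrMl// mulrC; have /andP[_] := truncn_itv q0.
  by move=> /lt_le_trans; apply; rewrite ler_nat.
rewrite -(ltr_pM2r n0); apply: le_lt_trans ne.
rewrite -[X in `|_| * X](ger0_norm (ltW n0)) -normrM mulrBl divfK ?gt_eqF//.
have := hC (iter n F t); have := hC t; rewrite iterC !ler_norml.
by move=> /andP[h1 h2] /andP[h3 h4]; apply/andP; split; lra.
Qed.

(** What is left of the line when the interiors of the inserted intervals are removed: a point of
    [D] contributes two points, any other point one. *)
Definition denjoy_cantor : set R := [set y | exists x, y = L x \/ y = U x].

Lemma denjoy_cantorP y :
  denjoy_cantor y <-> y = L (collapse y) \/ y = U (collapse y).
Proof.
split=> [[x [->|->]]|h]; last by exists (collapse y).
  by rewrite collapseL; left.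
by rewrite collapseU; right.
Qed.

Lemma denjoy_cantor_closed : closed denjoy_cantor.
Proof.
rewrite -openC; have -> : ~` denjoy_cantor = \bigcup_x `]L x, U x[%classic.
  apply/seteqP; split=> [y /= nK|y [x _] /=].
    exists (collapse y) => //=; rewrite in_itv/= !lt_neqAle andbACA collapse_itv andbT.
    by apply/andP; split; apply/eqP => e; apply: nK; exists (collapse y);
      [left|right].
  rewrite in_itv/= => /andP[h1 h2] /denjoy_cantorP.
  by rewrite (@collapse_unique _ _ _ _ LU_blow x) ?ltW//; lra.
by apply: bigcup_open => x _; exact: interval_open.
Qed.

Lemma denjoy_cantor_periodic : periodic1 denjoy_cantor.
Proof.
have [_ _ L1U1 _ _] := LU_blow.
move=> y; apply/propext; rewrite !denjoy_cantorP collapseD1.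
have [-> ->] := L1U1 (collapse y); lra.
Qed.

Lemma denjoy_cantor_image : denjoy_map @` (cover @` denjoy_cantor) = cover @` denjoy_cantor.
Proof.
apply/seteqP; split=> [_ [_ [y [x [->|->]] <-] <-]|_ [y [x [->|->]] <-]].
- by rewrite denjoy_mapE blown_rotationL; exists (L (x + alpha)) => //; exists (x + alpha); left.
- by rewrite denjoy_mapE blown_rotationU//; exists (U (x + alpha)) => //; exists (x + alpha); right.
- exists (cover (L (x - alpha))); last by rewrite denjoy_mapE blown_rotationL subrK.
  by exists (L (x - alpha)) => //; exists (x - alpha); left.
- exists (cover (U (x - alpha))); last by rewrite denjoy_mapE blown_rotationU// subrK.
  by exists (U (x - alpha)) => //; exists (x - alpha); right.
Qed.

Lemma denjoy_cantor_compact : compact (cover @` denjoy_cantor).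
Proof.
rewrite -(circle_cover_image_itv denjoy_cantor_periodic).
exact: circle_cover_compact_image denjoy_cantor_closed.
Qed.

Lemma denjoy_cantor_neq0 : cover @` denjoy_cantor !=set0.
Proof. by exists (cover (L 0)), (L 0) => //; exists 0; left. Qed.

Definition denjoy_system : subsystem denjoy_map :=
  Subsystem denjoy_cantor_compact denjoy_cantor_image denjoy_cantor_neq0.

(** The Cantor set is closed and invariant in both directions, and it misses the middle of an
    inserted interval, so its orbits are not dense in the circle. *)
Lemma denjoy_not_minimal : ~ minimal_system denjoy_map.
Proof.
have [LU UL L1U1 LUD _] := LU_blow.
set K := cover @` denjoy_cantor.
have Kinv n z : K z -> K (iter n denjoy_map z).
  move=> Kz; elim: n => //= n IH; rewrite -[X in X _]denjoy_cantor_image.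
  by exists (iter n denjoy_map z).
have Kpre n z : K (iter n denjoy_map z) -> K z.
  elim: n => //= n IH; rewrite -{1}[K]denjoy_cantor_image => -[w Kw].
  by move/(can_inj denjoy_mapK) => wz; apply: IH; rewrite -wz.
have [z Kz] := denjoy_cantor_neq0; have [x0 Dx0] := D_neq0.
move=> /(_ z (~` K)); case.
- have lt : L x0 < U x0 by exact/LUD.
  pose y := (L x0 + U x0) / 2; exists (cover y) => -[w Kw wy].
  have [m ym] := circle_coverP wy.
  have Ky : denjoy_cantor y by rewrite -(periodic1_int m _ denjoy_cantor_periodic) -ym.
  have cy : collapse y = x0.
    by apply: collapse_unique; rewrite /y; apply/andP; split; lra.
  by move/denjoy_cantorP : Ky; rewrite cy /y; lra.
- rewrite openC; apply: compact_closed; first exact: circle_hausdorff.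
  exact: denjoy_cantor_compact.
- move=> w [nKw [n [wE|zE]]]; apply: nKw.
    by rewrite wE; exact: Kinv.
  by apply: (Kpre n); rewrite -zE.
Qed.

Lemma denjoy_map_example : denjoy_example denjoy_map.
Proof.
split.
- exact: denjoy_map_homeomorphism.
- by exists F; exact: denjoy_lift.
- by exists alpha; first exact: denjoy_rotation_number.
- exact: denjoy_not_minimal.
Qed.

End DenjoyExample.

(** * Codings that are Denjoy minimal sets *)

Lemma continuous_injective_hausdorff (S T : topologicalType) (phi : S -> T) :
  continuous phi -> injective phi -> hausdorff_space T -> hausdorff_space S.
Proof.
move=> phic phi_inj hT p q cl; apply: phi_inj; apply: hT => A B Ap Bq.
have [z [Az Bz]] := cl _ _ (phic p A Ap) (phic q B Bq).
by exists (phi z).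
Qed.

Lemma homeomorphism_sym (T U : topologicalType) (phi : T -> U) :
  homeomorphism phi ->
  exists psi, [/\ homeomorphism psi, cancel phi psi & cancel psi phi].
Proof. by move=> [psi [h1 h2 h3 h4]]; exists psi; split => //; exists phi. Qed.

(** Serves to transport minimality from the coding to the Cantor set, where it is not proved
    directly. *)
Lemma conjugate_minimal (X Z : topologicalType) (h : X -> X) (k : Z -> Z) :
  conjugate h k -> minimal_system h -> minimal_system k.
Proof.
move=> [phi [[psi [phiK psiK phic psic]] hk]] hmin z O [w0 Ow0] oO.
have hkE x : phi (h x) = k (phi x) by have := congr1 (fun g => g x) hk.
have iterE n x : phi (iter n h x) = iter n k (phi x).
  by elim: n => //= n <-; exact: hkE.
have oO' : open (phi @^-1` O) by have /continuousP pc := phic; exact: pc.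
have [] := hmin (psi z) (phi @^-1` O) _ oO'.
  by exists (psi w0); rewrite /= psiK.
move=> w [Ow [n [wE|zE]]]; exists (phi w); split => //; exists n.
  by left; rewrite wE iterE psiK.
by right; rewrite -iterE -zE psiK.
Qed.

(** * Left limits and orbits of discontinuities *)

Section LeftLimits.
Variables (R : realType) (f : R -> bool) (alpha : R).
Hypothesis f_adm : admissible f.
Hypothesis f_left : has_left_limits f.

Definition left_value x : bool := projT1 (cid (f_left x)).

Lemma left_valueP x :
  exists2 e, 0 < e & forall z, x - e < z < x -> f z = left_value x.
Proof. exact: projT2 (cid (f_left x)). Qed.

Lemma left_value_unique x a c : a < x ->
  (forall z, a < z < x -> f z = c) -> left_value x = c.
Proof.
move=> ax fc; have [e e0 he] := left_valueP x.
pose z := Num.max ((a + x) / 2) (x - e / 2).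
have z1 : x - e < z by rewrite lt_max; apply/orP; right; lra.
have z2 : a < z by rewrite lt_max; apply/orP; left; lra.
have z3 : z < x by rewrite gt_max; apply/andP; split; lra.
by rewrite -(he z) ?(fc z) ?z2//; rewrite z1.
Qed.

Lemma left_value_periodic : periodic1 left_value.
Proof.
move=> x; have [e e0 he] := left_valueP x.
apply: (@left_value_unique _ (x + 1 - e)); first by lra.
move=> z /andP[z1 z2]; rewrite -[z](subrK 1) f_adm.1 he//.
by apply/andP; split; lra.
Qed.

Lemma left_value_locally_constant x :
  left_value x = f x <-> locally_constant_at f x.
Proof.
split=> [lf|[e e0 he]]; last first.
  apply: (@left_value_unique _ (x - e)); first by lra.
  by move=> z /andP[z1 z2]; apply: he; rewrite ltr_norml; apply/andP; split; lra.
have [e e0 he] := left_valueP x; have [e' e'0 he'] := f_adm.2 x.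
exists (Num.min e e'); first by rewrite lt_min e0.
move=> y; rewrite lt_min !ltr_norml => /andP[/andP[y1 y2] /andP[y3 y4]].
have [xy|yx] := leP x y; first by apply: he'; apply/andP; split; lra.
by rewrite -lf; apply: he; apply/andP; split; lra.
Qed.

(** As [y] is strictly to the right of [x], a small left neighbourhood of [y] still lies in the
    piece where the itinerary is constant; at [x] itself the left limits may differ. *)
Lemma itinerary_right_near x N : exists2 e, 0 < e & forall y, x < y < x + e ->
  agree N (itinerary alpha f x) (itinerary alpha f y) /\
  agree N (itinerary alpha f x) (itinerary alpha left_value y).
Proof.
have [e e0 he] := itinerary_right alpha f_adm.2 x N; exists e => // y /andP[xy ye].
split=> [|i iN]; first by apply: he; rewrite ltW.
apply/esym; apply: (@left_value_unique _ (x + i%:~R * alpha)); first by lra.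
move=> z /andP[z1 z2]; have := he (z - i%:~R * alpha) _ i iN.
by rewrite /itinerary subrK => -> //; apply/andP; split; lra.
Qed.

Lemma itinerary_left_near x N : exists2 e, 0 < e & forall y, x - e < y < x ->
  agree N (itinerary alpha left_value x) (itinerary alpha f y) /\
  agree N (itinerary alpha left_value x) (itinerary alpha left_value y).
Proof.
have one (i : int) : exists2 e, 0 < e & forall y, x - e < y < x ->
    itinerary alpha left_value x i = itinerary alpha f y i.
  have [e e0 he] := left_valueP (x + i%:~R * alpha); exists e => // y /andP[h1 h2].
  by rewrite /itinerary he//; apply/andP; split; lra.
have [e e0 he] : exists2 e, 0 < e & forall y, x - e < y < x ->
    agree N (itinerary alpha left_value x) (itinerary alpha f y).
  elim: N => [|N [e e0 he]].
    have [e e0 he] := one 0; exists e => // y /he h i.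
    by rewrite leqn0 absz_eq0 => /eqP ->.
  have [e1 e10 he1] := one N.+1; have [e2 e20 he2] := one (- N.+1%:Z).
  exists (Num.min e (Num.min e1 e2)); first by rewrite !lt_min e0 e10.
  move=> y; rewrite ltrBlDr -ltrBlDl !lt_min.
  move=> /andP[/andP[h /andP[h1 h2]] yx] i.
  rewrite leq_eqVlt => /orP[/eqP iN|iN].
    have [->|->] : i = N.+1 \/ i = - N.+1%:Z by lia.
      by apply: he1; apply/andP; split; lra.
    by apply: he2; apply/andP; split; lra.
  by apply: he => //; apply/andP; split; lra.
exists e => // y /andP[y1 y2]; split; first by apply: he; rewrite y1.
move=> i iN; apply/esym.
apply: (@left_value_unique _ (x - e + i%:~R * alpha)); first by lra.
move=> z /andP[z1 z2]; have := he (z - i%:~R * alpha) _ i iN.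
by rewrite {2}/itinerary subrK => -> //; apply/andP; split; lra.
Qed.

(** The set to be blown up. Discontinuities are completed to full orbits so that the rotation lifts
    to the blown-up line. *)
Definition jump_orbits : set R :=
  [set x | exists n : int, left_value (x + n%:~R * alpha) <> f (x + n%:~R * alpha)].

Lemma jump_orbits_alpha x : jump_orbits (x + alpha) <-> jump_orbits x.
Proof.
split=> -[n hn].
  exists (n + 1); have -> : x + (n + 1)%:~R * alpha = x + alpha + n%:~R * alpha.
    by rewrite intrD; ring.
  exact: hn.
exists (n - 1); have -> : x + alpha + (n - 1)%:~R * alpha = x + n%:~R * alpha.
  by rewrite intrB; ring.
exact: hn.
Qed.

End LeftLimits.

Section JumpEnumeration.
Variables (R : realType) (f : R -> bool) (alpha : R).
Hypothesis f_adm : admissible f.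
Hypothesis f_left : has_left_limits f.
Local Notation lv := (left_value f_left).
Local Notation jumps := (jump_orbits alpha f_left).

Lemma jump_orbits_periodic : periodic1 jumps.
Proof.
move=> x; have e n : x + 1 + n%:~R * alpha = x + n%:~R * alpha + 1 by ring.
by apply/propext; split=> -[n hn]; exists n; move: hn;
  rewrite ?e ?(left_value_periodic f_adm) ?f_adm.1.
Qed.

(** A discontinuity is a boundary point of the level set of its own value, and level sets are open
    to the right. *)
Lemma discontinuities_countable : countable [set x | lv x <> f x].
Proof.
pose A b : set R := [set x | f x = b].
have oA b : right_open (A b).
  by move=> x <-; have [e e0 he] := f_adm.2 x; exists e.
apply: (@sub_countable _ _ _ (\bigcup_b (A b `\` (A b)^°))).
  apply: subset_card_le => x nlc.
  have inA : A (f x) x by [].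
  have nint : ~ (A (f x))^° x.
    move=> /nbhs_ballP[e /= e0 he]; apply: nlc.
    apply/(left_value_locally_constant f_adm); exists e => // y yx.
    by apply: he; rewrite /ball/= distrC.
  by exists (f x).
apply: bigcup_countable => [|b _]; first exact: countableP.
exact: right_open_boundary.
Qed.

Lemma jump_orbits_countable : countable jumps.
Proof.
have -> : jumps = \bigcup_(n : int) [set x - n%:~R * alpha | x in [set x | lv x <> f x]].
  apply/seteqP; split=> [x [n hn]|_ [n _ [x hx <-]]].
    by exists n => //; exists (x + n%:~R * alpha); rewrite ?addrK.
  by exists n; rewrite subrK.
apply: bigcup_countable => [|n _]; first exact: countableP.
apply: sub_countable discontinuities_countable; exact: card_image_le.
Qed.

(** [jump_set] takes a sequence indexed by all of [nat]; indices that the injection [c] does not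
    take on jump points of [0, 1) receive a fixed element of the set, so values may repeat. *)
Lemma jump_orbits_enum : jumps !=set0 -> exists2 d : nat -> R,
  (forall k, 0 <= d k < 1) & jump_set d = jumps.
Proof.
move=> [x0 jx0].
have jfp x : jumps x -> jumps (fpart x).
  by rewrite /fpart -intrN (periodic1_int _ _ jump_orbits_periodic).
have /countable_injP[c cinj] := jump_orbits_countable.
have /choice[d hd] k : exists y, (0 <= y < 1 /\ jumps y) /\
    forall x, 0 <= x < 1 -> jumps x -> c x = k -> y = x.
  have [[x [[x01 jx] cx]]|no] :=
    pselect (exists x, (0 <= x < 1 /\ jumps x) /\ c x = k).
    exists x; split => // y _ jy cy.
    by apply: cinj; rewrite ?inE// cx.
  exists (fpart x0); split; first by split; [exact: fpart_itv|exact: jfp].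
  by move=> x x01 jx cx; case: no; exists x.
exists d; first by move=> k; have [[]] := hd k.
apply/seteqP; split=> [_ [k [m ->]]|x jx].
  by rewrite (periodic1_int _ _ jump_orbits_periodic); have [[]] := hd k.
exists (c (fpart x)), (Num.floor x).
have [_ h] := hd (c (fpart x)).
by rewrite (h _ (fpart_itv x) (jfp _ jx))// /fpart subrK.
Qed.

End JumpEnumeration.

(** * Conjugacy between the Cantor set and the coding *)

Section CodingConjugacy.
Variables (R : realType) (f : R -> bool) (alpha : R).
Hypothesis alpha_irr : irrational alpha.
Hypothesis f_adm : admissible f.
Hypothesis f_left : has_left_limits f.
Hypothesis f_rigid : forall rho, (forall u, f u = f (u + rho)) ->
  exists m : int, rho = m%:~R.
Local Notation lv := (left_value f_left).
Local Notation jumps := (jump_orbits alpha f_left).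
Hypothesis jumps_neq0 : jumps !=set0.
Variables (L U : R -> R).
Hypothesis LU_blow : blow_up jumps L U.
Local Notation cover := (@circle_cover R).
Local Notation collapse := (collapse LU_blow).
Local Notation g := (denjoy_map LU_blow alpha).
Local Notation cantor := (denjoy_cantor L U).
Local Notation K := (denjoy_system LU_blow (jump_orbits_alpha alpha f_left)).
Local Notation Y := (coding_system alpha f).

Let LU x : L x <= U x. Proof. by case: LU_blow. Qed.
Let UL x y : x < y -> U x < L y. Proof. by case: LU_blow => _ h _ _ _; exact: h. Qed.
Let L1 x : L (x + 1) = L x + 1. Proof. by case: LU_blow => _ _ h _ _; case: (h x). Qed.
Let U1 x : U (x + 1) = U x + 1. Proof. by case: LU_blow => _ _ h _ _; case: (h x). Qed.
Let LUD x : jumps x <-> L x < U x. Proof. by case: LU_blow. Qed.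

(* The ends U x and L x of the interval replacing x are coded by f and by its
   limits from the left; interior points get an irrelevant value. *)
Definition code y : Sigma2 :=
  if y == U (collapse y) then itinerary alpha f (collapse y)
  else itinerary alpha lv (collapse y).

Lemma codeU x : code (U x) = itinerary alpha f x.
Proof. by rewrite /code collapseU eqxx. Qed.

(** When [L x = U x], the point [x] lies outside [jumps] and its two itineraries coincide. *)
Lemma codeL x : code (L x) = itinerary alpha lv x.
Proof.
rewrite /code collapseL; case: eqP => // e.
apply/funext => n; apply: contrapT => ne.
by have : jumps x by [exists n; exact: nesym]; rewrite LUD e ltxx.
Qed.

Lemma code_cases y : code y = itinerary alpha f (collapse y) \/
  code y = itinerary alpha lv (collapse y).
Proof. by rewrite /code; case: ifP; [left|right]. Qed.

Lemma code_periodic : periodic1 code.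
Proof.
move=> y; rewrite /code collapseD1 U1 (inj_eq (addIr 1)).
have iper h : periodic1 h -> itinerary alpha h (collapse y + 1) = itinerary alpha h (collapse y).
  by move=> hper; exact: (itineraryDint alpha hper (collapse y) 1).
by rewrite (iper _ f_adm.1) (iper _ (left_value_periodic f_adm f_left)).
Qed.

(** Beyond [U x], base points lie strictly to the right of [x], and near [x] both itineraries of
    such a base point agree with that of [x] on the window. *)
Lemma code_right x N : exists2 v, U x < v & forall y, U x < y < v ->
  agree N (itinerary alpha f x) (code y).
Proof.
have [e e0 he] := itinerary_right_near alpha f_adm f_left x N.
exists (L (x + e)); first by apply: UL; lra.
move=> y /andP[y1 y2]; have /andP[c1 c2] := collapse_itv LU_blow y.
have xc : x < collapse y.
  rewrite ltNge le_eqVlt; apply/negP => /orP[/eqP cx|/UL].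
    by rewrite cx in c2; lra.
  by have := LU x; lra.
have cxe : collapse y < x + e.
  rewrite ltNge le_eqVlt; apply/negP => /orP[/eqP cx|/UL].
    by rewrite -cx in c1; lra.
  by have := LU (x + e); lra.
have [h1 h2] := he (collapse y) (ltac:(by rewrite xc)).
by have [->|->] := code_cases y.
Qed.

Lemma code_left x N : exists2 u, u < L x & forall y, u < y < L x ->
  agree N (itinerary alpha lv x) (code y).
Proof.
have [e e0 he] := itinerary_left_near alpha f_left x N.
exists (U (x - e)); first by apply: UL; lra.
move=> y /andP[y1 y2]; have /andP[c1 c2] := collapse_itv LU_blow y.
have xc : collapse y < x.
  rewrite ltNge le_eqVlt; apply/negP => /orP[/eqP cx|/UL].
    by rewrite -cx in c1; lra.
  by have := LU x; lra.
have cxe : x - e < collapse y.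
  rewrite ltNge le_eqVlt; apply/negP => /orP[/eqP cx|/UL].
    by rewrite cx in c2; lra.
  by have := LU (x - e); lra.
have [h1 h2] := he (collapse y) (ltac:(by rewrite xc cxe)).
by have [->|->] := code_cases y.
Qed.

(** The two ends of a nondegenerate inserted interval have different codes, so a neighbourhood of
    one must exclude the other. When the interval is a point, both one-sided estimates apply because
    the two codes coincide. *)
Lemma code_near y N : cantor y -> exists2 e, 0 < e &
  forall y', cantor y' -> `|y' - y| < e -> agree N (code y) (code y').
Proof.
move=> /(denjoy_cantorP LU_blow); set x := collapse y => yx.
have [v v0 hv] := code_right x N; have [u u0 hu] := code_left x N.
pose q := if L x < U x then U x - L x else 1.
have q0 : 0 < q by rewrite /q; case: ifP => //; rewrite subr_gt0.
pose e := Num.min q (Num.min (v - U x) (L x - u)).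
exists e; first by rewrite !lt_min q0 !subr_gt0 v0 u0.
have [eq [ev eu]] : e <= q /\ e <= v - U x /\ e <= L x - u.
  by split; [|split]; rewrite /e !ge_min lexx ?orbT.
have qLU : L x < U x -> e <= U x - L x by move=> h; move: eq; rewrite /q h.
have LUE : ~~ (L x < U x) -> U x = L x.
  by move=> h; apply/eqP; rewrite eq_le LU andbT leNgt.
move=> y' Ky'; rewrite ltr_norml => /andP[n1 n2].
have [Uy'|y'U] := ltP (U x) y'.
  have yU : y = U x.
    by case: yx => // yL; have [/qLU|/LUE] := boolP (L x < U x); lra.
  by rewrite yU codeU; apply: hv; rewrite Uy'/=; lra.
have [y'L|Ly'] := ltP y' (L x).
  have yL : y = L x.
    by case: yx => // yU; have [/qLU|/LUE] := boolP (L x < U x); lra.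
  by rewrite yL codeL; apply: hu; rewrite y'L andbT; lra.
have cy' : collapse y' = x by apply: collapse_unique; rewrite Ly'.
have -> : y' = y; last by [].
move/(denjoy_cantorP LU_blow) : Ky'; rewrite cy'.
by have [/qLU|/LUE] := boolP (L x < U x) => h [e1|e1]; case: yx => e2; lra.
Qed.

Lemma code_coding y : coding alpha f (code y).
Proof.
have [->|->] := code_cases y; first exact: itinerary_coding.
apply/codingP => N; have [e e0 he] := itinerary_left_near alpha f_left (collapse y) N.
have [h _] := he (collapse y - e / 2) (ltac:(by apply/andP; split; lra)).
by exists (collapse y - e / 2).
Qed.

Lemma code_blown_rotation y : cantor y ->
  code (blown_rotation LU_blow alpha y) = shift_map (code y).
Proof.
move=> [x [->|->]].
  by rewrite blown_rotationL !codeL shift_itinerary.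
rewrite (blown_rotationU LU_blow (jump_orbits_alpha alpha f_left)) !codeU.
by rewrite shift_itinerary.
Qed.

Let lift_ex (z : subspace_of K) : exists y, cantor y /\ cover y = inclusion K z.
Proof. by have [y Ky yz] := inclusionP z; exists y. Qed.

Definition lift z : R := projT1 (cid (lift_ex z)).

Lemma lift_cantor z : cantor (lift z).
Proof. by have [] := projT2 (cid (lift_ex z)). Qed.

Lemma lift_cover z : cover (lift z) = inclusion K z.
Proof. by have [] := projT2 (cid (lift_ex z)). Qed.

Lemma code_cover y y' : cover y = cover y' -> code y = code y'.
Proof. by move=> /circle_coverP[m ->]; rewrite periodic1_int//; exact: code_periodic. Qed.

Definition code_map (z : subspace_of K) : subspace_of Y :=
  exist _ (code (lift z)) (mem_set (@code_coding (lift z))).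

Lemma code_map_cover z y : cover y = inclusion K z ->
  inclusion Y (code_map z) = code y.
Proof. by move=> yz; apply: code_cover; rewrite lift_cover. Qed.

Lemma code_map_shift z :
  code_map (subsystem_map K z) = subsystem_map Y (code_map z).
Proof.
apply: inclusion_inj.
have e : inclusion Y (subsystem_map Y (code_map z)) = shift_map (code (lift z)) by [].
rewrite e -(code_blown_rotation (lift_cantor z)).
by apply: code_map_cover; rewrite -denjoy_mapE lift_cover.
Qed.

(** [lift] is an arbitrary section; as for [circle_map], a closed set is pulled back to a closed
    periodic set of the line and projected through [0, 1]. *)
Lemma code_map_continuous : continuous code_map.
Proof.
apply: (@continuous_comp_initial _ (subspace_of K)).
apply/continuous_closedP => C cC.
pose A : set R := [set y | cantor y /\ C (code y)].
have pA : periodic1 A.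
  by move=> y; rewrite /A/= code_periodic (denjoy_cantor_periodic LU_blow).
have cA : closed A.
  rewrite -openC openE => y nA; have [Ky|nKy] := pselect (cantor y); last first.
    have oK : open (~` cantor) by rewrite openC; exact: denjoy_cantor_closed LU_blow.
    by apply: filterS (open_nbhs_nbhs (conj oK nKy)) => y' nKy' [].
  have nC : (~` C) (code y) by move=> Cy; apply: nA.
  have oC : open (~` C) by rewrite openC.
  have [N hN] := nbhs_Sigma2 (open_nbhs_nbhs (conj oC nC)).
  have [e e0 he] := code_near N Ky.
  apply/nbhs_ballP; exists e => //= y' yy' [Ky' Cy'].
  by apply: (hN _ _ Cy'); apply: he => //; rewrite distrC.
have -> : (set_val \o code_map) @^-1` C = inclusion K @^-1` (cover @` (A `&` `[0, 1]%classic)).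
  rewrite circle_cover_image_itv//; apply/seteqP; split=> [z Cz|z [y [Ky Cy] yz]].
    by exists (lift z); [split => //; exact: lift_cantor|exact: lift_cover].
  by rewrite /= -/(inclusion Y (code_map z)) (code_map_cover yz).
have /continuous_closedP ic : continuous (inclusion K) by exact: inclusion_continuous.
apply: ic; apply: compact_closed; first exact: circle_hausdorff.
exact: circle_cover_compact_image.
Qed.

Lemma code_base y (i : int) :
  locally_constant_at f (collapse y + i%:~R * alpha) ->
  code y i = f (collapse y + i%:~R * alpha).
Proof.
move=> lc; have [->//|->] := code_cases y.
exact/(left_value_locally_constant f_adm f_left).
Qed.

(** Equal codes give equal translates of [f] along the two base points, and rigidity makes these
    equal modulo 1. The two ends of an inserted interval are told apart because their itineraries
    differ where the orbit meets a discontinuity. *)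
Lemma code_map_injective : injective code_map.
Proof.
move=> z z' zz'; apply: inclusion_inj; rewrite -!lift_cover.
set y := lift z; set y' := lift z'.
have cyy' : code y = code y' by have := congr1 (inclusion Y) zz'.
have tr u : f (collapse y + u) = f (collapse y' + u).
  apply: (coding_translate alpha_irr) => // i lc lc'.
  by rewrite -code_base// -code_base// cyy'.
have [v|m yy'] := f_rigid (rho := collapse y' - collapse y).
  by rewrite -[v in LHS](subrK (collapse y)) addrC tr; congr f; ring.
have cE : collapse y' = collapse y + m%:~R by rewrite -yy'; ring.
have pc : periodic1 (fun w => collapse w - w).
  by move=> w; rewrite collapseD1; ring.
have cm : collapse (y' - m%:~R) = collapse y.
  by have := periodic1_int (- m) y' pc; rewrite intrN cE; lra.
suff <- : y' - m%:~R = y.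
  by rewrite -intrN periodic1_int//; exact: circle_cover_periodic.
have Ky : cantor y := lift_cantor z.
have Ky' : cantor (y' - m%:~R).
  by rewrite -intrN (periodic1_int _ _ (denjoy_cantor_periodic LU_blow)); exact: lift_cantor.
have code' : code (y' - m%:~R) = code y.
  by rewrite -intrN periodic1_int// ?cyy'//; exact: code_periodic.
have nojump : ~ (itinerary alpha f (collapse y) = itinerary alpha lv (collapse y) /\
    L (collapse y) < U (collapse y)).
  by move=> [e /LUD[n]]; apply; have /(congr1 (fun s => s n)) := e.
have LUe : itinerary alpha f (collapse y) = itinerary alpha lv (collapse y) ->
    L (collapse y) = U (collapse y).
  move=> e; apply/eqP; rewrite eq_le LU leNgt; apply/negP => lt; exact: nojump.
move: code'; move/(denjoy_cantorP LU_blow) : Ky'; rewrite cm.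
move/(denjoy_cantorP LU_blow) : Ky => [ey|ey] [ey'|ey'].
- by rewrite ey' -ey.
- by rewrite ey' [in X in _ = code X]ey codeU codeL => /LUe <-.
- by rewrite ey' [in X in _ = code X]ey codeU codeL => /esym/LUe ->.
- by rewrite ey' -ey.
Qed.

(** The image is compact and contains every itinerary, as the code of some [U x]; hence it contains
    the closure of their set. *)
Lemma code_map_surjective w : exists z, code_map z = w.
Proof.
have cK : compact [set: subspace_of K].
  by apply: compact_set_type; exact: denjoy_cantor_compact LU_blow.
have cI : closed (range (inclusion Y \o code_map)).
  apply: compact_closed; first exact: Sigma2_hausdorff.
  apply: continuous_compact => //; apply: continuous_subspaceT => z.
  by apply: continuous_comp; [exact: code_map_continuous|exact: inclusion_continuous].
have sub : coding alpha f `<=` range (inclusion Y \o code_map).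
  rewrite /coding [X in _ `<=` X](closure_id _).1//; apply: closure_subset.
  move=> _ [x _ <-].
  have KU : carrier K (cover (U x)) by exists (U x) => //; exists x; right.
  exists (exist _ (cover (U x)) (mem_set KU)) => //=.
  by rewrite -codeU; exact: code_map_cover.
have [z _ zw] := sub _ (inclusionP w).
by exists z; exact: inclusion_inj.
Qed.

Lemma coding_denjoy : denjoy_minimal R (subsystem_map Y).
Proof.
have cK : compact [set: subspace_of K].
  by apply: compact_set_type; exact: denjoy_cantor_compact LU_blow.
have hY : hausdorff_space (subspace_of Y).
  apply: (continuous_injective_hausdorff _ (@inclusion_inj _ _ Y)).
    exact: inclusion_continuous.
  exact: Sigma2_hausdorff.
have [psi [psih codeK psiK]] := homeomorphism_sym (compact_hausdorff_homeomorphism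
  cK hY code_map_continuous code_map_injective code_map_surjective).
have conj : conjugate (subsystem_map Y) (subsystem_map K).
  exists psi; split => //; apply/funext => w /=.
  by rewrite -[in LHS](psiK w) -code_map_shift codeK.
exists g; first exact: (denjoy_map_example LU_blow alpha_irr
  (jump_orbits_alpha alpha f_left) jumps_neq0).
exists K => //; apply: conjugate_minimal conj _.
exact: coding_minimal alpha_irr f_adm.1 f_adm.2.
Qed.

End CodingConjugacy.

(** * Balls of Denjoy minimal sets *)

Section DenjoyBalls.
Variables (R : realType) (alpha : R) (n : nat).
Hypothesis alpha_irr : irrational alpha.
Local Notation act := (fun j => j < n)%N.

Lemma bar_point_denjoy (T : topologicalType) (p : T -> nat -> R)
    (p01 : forall x j, 0 <= p x j <= 1) x :
  denjoy_sets R shift_map (bar_point act alpha_irr p01 x).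
Proof.
have fA := bar_symbol_admissible act (p01 x).
have fl : has_left_limits (bar_symbol act (p x)).
  exact: (@bar_symbol_left_limits _ _ _ n).
have rigid rho : (forall u, bar_symbol act (p x) u = bar_symbol act (p x) (u + rho)) ->
    exists m : int, rho = m%:~R.
  by move=> h; have [] := bar_symbol_rigid (p01 x) (p01 x) h.
have jump : jump_orbits alpha fl !=set0.
  (* The right end of the marker is a discontinuity even for [n = 0]: [true] from the left, [false]
     at 1/2. *)
  exists (1 / 2), 0; rewrite mul0r addr0.
  rewrite (@left_value_unique _ _ fl _ 0 true); first last.
  - by move=> z /andP[z0 z1]; rewrite bar_symbol_marker// z1 ltW.
  - by lra.
  have h : 1 / 2 = 1 - gap R 0 by rewrite gap0; lra.
  have g := gap_gt0 R 0; have g1 := gapS R 0.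
  rewrite h (@bar_symbol_block _ _ _ (p01 x) 0); last by apply/andP; split; lra.
  suff -> : bar_left R 0 <= 1 - gap R 0 = false by rewrite andbF.
  by apply/negbTE; rewrite -ltNge /bar_left; lra.
have [d d01 dE] := jump_orbits_enum fA jump.
have [L [U]] := blow_up_exists d01; rewrite dE => LU.
exact (coding_denjoy alpha_irr fA rigid jump LU).
Qed.

Lemma euclidean_ball_compact : compact [set: euclidean_ball R n].
Proof.
apply: compact_set_type.
have box := @rV_compact R n (fun=> `[-1, 1]%classic) (fun=> @segment_compact R (-1) 1).
apply: subclosed_compact box _ => [|x /= x1 i].
  apply: (@closed_comp _ _ (fun x : 'rV[R]_n => \sum_(i < n) x ord0 i ^+ 2) [set y | y <= 1]).
    move=> v _; apply: (@continuous_big R 'I_n +%R 0 predT (@add_continuous R)).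
    move=> i _ w; apply: (@continuous_comp 'rV[R]_n R R (fun v => v ord0 i) (fun y => y ^+ 2)).
      exact: coord_continuous.
    exact: exprn_continuous.
  exact: closed_le.
rewrite in_itv/= -ler_norml -(ler_pXn2r (n := 2))// ?nnegrE//.
rewrite real_normK ?num_real// expr1n; apply: le_trans x1.
by rewrite (bigD1 i)//= lerDl sumr_ge0// => j _; exact: sqr_ge0.
Qed.

(** The affine map carries the coordinate range [-1, 1] onto the parameter range [0, 1]. *)
Definition ball_param (x : euclidean_ball R n) (j : nat) : R :=
  if insub j is Some i then (1 + val x ord0 i) / 2 else 0.

Lemma ball_coord (x : euclidean_ball R n) (i : 'I_n) : -1 <= val x ord0 i <= 1.
Proof.
have /= := set_valP x => x1; rewrite -ler_norml -(ler_pXn2r (n := 2))// ?nnegrE//.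
rewrite real_normK ?num_real// expr1n; apply: le_trans x1.
by rewrite (bigD1 i)//= lerDl sumr_ge0// => j _; exact: sqr_ge0.
Qed.

Lemma ball_param_itv x j : 0 <= ball_param x j <= 1.
Proof.
rewrite /ball_param; case: insubP => [i _ _|_]; last by rewrite lexx ler01.
by have /andP[h1 h2] := ball_coord x i; apply/andP; split; lra.
Qed.

Lemma half_coord_continuous (T : topologicalType) (v : T -> 'rV[R]_n) i :
  continuous v -> continuous (fun x => (1 + v x ord0 i) / 2).
Proof.
move=> cv x; apply/cvgrPdist_lt => e e0.
have /cvgrPdist_lt/(_ _ e0) := continuous_comp (cv x) (@coord_continuous R 1 n ord0 i _).
apply: filterS => y /=; apply: le_lt_trans.
rewrite (_ : _ - _ = (v x ord0 i - v y ord0 i) / 2); last by ring.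
by rewrite normrM [X in _ * X]ger0_norm ?invr_ge0// ler_piMr// invf_le1// ler1n.
Qed.

Lemma ball_param_continuous j : continuous (fun x => ball_param x j).
Proof.
rewrite /ball_param; case: insub => [i|]; last exact: cst_continuous.
have cv : continuous (set_val : euclidean_ball R n -> 'rV[R]_n).
  exact: initial_continuous.
exact (@half_coord_continuous _ _ i cv).
Qed.

Lemma euclidean_ball_copy :
  contains_copy (set_type (denjoy_sets R shift_map)) (euclidean_ball R n).
Proof.
apply: (@subset_copy R act alpha alpha_irr _ _ ball_param_itv).
- exact: ball_param_continuous.
- move=> x y xy; apply: contrapT => no; apply: xy; apply: val_inj.
  apply/rowP => i; apply: contrapT => ne; apply: no.
  exists (val i); first exact: ltn_ord.
  by rewrite /ball_param valK; lra.
- exact: euclidean_ball_compact.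
- by move=> x; exact: bar_point_denjoy.
Qed.

End DenjoyBalls.

Theorem theorem0p1 (R : realType) :
  contains_copy (ergodic_sets R shift_map) (hilbert_cube R) /\
  forall n : nat,
    contains_copy (set_type (denjoy_sets R shift_map)) (euclidean_ball R n).
Proof.
split; first exact: hilbert_cube_copy.
by move=> n; exact: euclidean_ball_copy pi_irrationnal.
Qed.
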